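(* Let $M$ be an inverse monoid generated (as an inverse monoid) by a finite set $X$ with $|X|\ge 2$. Then $$\alpha(M,X)\le \alpha(\mathrm{FIM}_X,X),$$ with equality if and only if $M=\mathrm{FIM}_X$, i.e. if and only if the canonical surjective homomorphism $\mathrm{FIM}_X\to M$ extending the identity on $X$ is an isomorphism.
   Context: $\mathrm{FIM}_X$ denotes the free inverse monoid on $X$. Let $\tilde X=X\cup X^{-1}$, where $X^{-1}=\{x^{-1}: x\in X\}$ is a disjoint copy of $X$. For an inverse monoid $M$ generated by $X$, let $\pi:\tilde X^*\to M$ be the canonical surjective monoid homomorphism ($x\mapsto x$, $x^{-1}\mapsto$ the inverse of $x$ in $M$), and for $g\in M$ let $|g|_X$ be the minimal length of a word $w\in\tilde X^*$ with $w\pi=g$. The exponential growth rate is $$\alpha(M,X)=\limsup_{n\to\infty}\sqrt[n]{\gamma(n)},\qquad \gamma(n)=\#\{g\in M: |g|_X=n\}.$$ *)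

(* Defs.v *)
From HB Require Import structures.
From mathcomp Require Import all_boot all_order all_algebra.
From mathcomp Require Import finmap.
From mathcomp Require Import all_classical all_reals all_analysis.

Set Implicit Arguments.
Unset Strict Implicit.
Unset Printing Implicit Defensive.

Local Open Scope classical_set_scope.
Local Open Scope group_scope.
Local Open Scope quotient_scope.

(* An inverse monoid is a monoid in which every x has exactly one y such that
   x y x = x and y x y = y. The operation x |-> x^-1 is then an involutive
   antiautomorphism, so the structure sits above [starMonoidType]; the factory
   [Monoid_isInverseMonoid] builds it from the textbook axioms alone. *)
HB.mixin Record StarMonoid_isInverseMonoid G of StarMonoid G := {
  mulgVgK : forall x : G, x * x^-1 * x = x;
  invg_unique : forall x y : G, x * y * x = x -> y * x * y = y -> y = x^-1
}.

#[short(type="inverseMonoidType")]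
HB.structure Definition InverseMonoid :=
  { G of StarMonoid_isInverseMonoid G & StarMonoid G }.

HB.factory Record Monoid_isInverseMonoid G of Monoid G := {
  inv : G -> G;
  mulgVgK : forall x : G, x * inv x * x = x;
  mulVgVK : forall x : G, inv x * x * inv x = inv x;
  invg_unique : forall x y : G, x * y * x = x -> y * x * y = y -> y = inv x
}.

HB.builders Context G of Monoid_isInverseMonoid G.

Let idem (e : G) := e * e = e.

Let invgK' : involutive inv.
Proof. by move=> x; rewrite -(invg_unique (mulVgVK x) (mulgVgK x)). Qed.

Let idem_inv e : idem e -> inv e = e.
Proof. by move=> ee; rewrite -(@invg_unique e e) // ee ee. Qed.

Let idemM e f : idem e -> idem f -> idem (e * f).
Proof.
move=> ee ff; set x := inv (e * f).
have xE : f * x * e = x.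
  apply: invg_unique.
    have -> : e * f * (f * x * e) * (e * f)
              = e * (f * f) * x * (e * e) * f by rewrite !mulgA.
    by rewrite ee ff -[_ * e * f]mulgA mulgVgK.
  have -> : f * x * e * (e * f) * (f * x * e)
            = f * (x * ((e * e) * (f * f)) * x) * e by rewrite !mulgA.
  by rewrite ee ff mulVgVK.
have xx : idem x.
  rewrite /idem -{1 2}xE.
  have -> : f * x * e * (f * x * e) = f * (x * (e * f) * x) * e.
    by rewrite !mulgA.
  by rewrite mulVgVK.
by have := idem_inv xx; rewrite /x invgK' -/x => ->.
Qed.

Let idemC e f : idem e -> idem f -> e * f = f * e.
Proof.
move=> ee ff; have ef := idemM ee ff; have fe := idemM ff ee.
rewrite -[LHS](idem_inv ef); apply/esym/invg_unique.
  have -> : e * f * (f * e) * (e * f) = e * (f * f) * (e * e) * f.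
    by rewrite !mulgA.
  by rewrite ee ff -[RHS]ef !mulgA.
have -> : f * e * (e * f) * (f * e) = f * (e * e) * (f * f) * e.
  by rewrite !mulgA.
by rewrite ee ff -[RHS]fe !mulgA.
Qed.

Let invgM' : forall x y, inv (x * y) = inv y * inv x.
Proof.
move=> x y.
have xVx : idem (inv x * x) by rewrite /idem mulgA mulVgVK.
have yyV : idem (y * inv y) by rewrite /idem mulgA mulgVgK.
apply/esym/invg_unique.
  have -> : x * y * (inv y * inv x) * (x * y)
            = x * ((y * inv y) * (inv x * x)) * y by rewrite !mulgA.
  rewrite (idemC yyV xVx).
  have -> : x * (inv x * x * (y * inv y)) * y
            = (x * inv x * x) * (y * inv y * y) by rewrite !mulgA.
  by rewrite !mulgVgK.
have -> : inv y * inv x * (x * y) * (inv y * inv x)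
          = inv y * ((inv x * x) * (y * inv y)) * inv x by rewrite !mulgA.
rewrite (idemC xVx yyV).
have -> : inv y * (y * inv y * (inv x * x)) * inv x
          = (inv y * y * inv y) * (inv x * x * inv x) by rewrite !mulgA.
by rewrite !mulVgVK.
Qed.

HB.instance Definition _ := hasInv.Build G inv.
HB.instance Definition _ := Monoid_isStarMonoid.Build G invgK' invgM'.
HB.instance Definition _ :=
  StarMonoid_isInverseMonoid.Build G mulgVgK invg_unique.

HB.end.

Lemma inverse_exists_unique (M : inverseMonoidType) (x : M) :
  exists! y : M, x * y * x = x /\ y * x * y = y.
Proof.
exists x^-1; split=> [|y [xyx yxy]]; last exact/esym/invg_unique.
by split; rewrite ?mulgVgK // -{2}(invgK x) mulgVgK.
Qed.

Definition inverse_submonoid (M : inverseMonoidType) (S : set M) : Prop :=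
  [/\ S 1, forall x y, S x -> S y -> S (x * y) & forall x, S x -> S x^-1].

Definition generates (M : inverseMonoidType) (A : set M) : Prop :=
  forall S : set M, inverse_submonoid S -> A `<=` S -> S = setT.

(* Words over the doubled alphabet: [inl x] is the letter x and [inr x] is the
   letter x^-1. *)
Definition invword (X : Type) := seq (X + X).

Definition inv_letter (X : Type) (a : X + X) : X + X :=
  match a with inl x => inr x | inr x => inl x end.

Definition inv_word (X : Type) (w : invword X) : invword X :=
  rev (map (@inv_letter X) w).

Lemma inv_letterK (X : Type) : involutive (@inv_letter X).
Proof. by case. Qed.

Lemma inv_wordK (X : Type) : involutive (@inv_word X).
Proof. by move=> w; rewrite /inv_word map_rev revK (mapK (@inv_letterK X)). Qed.

Lemma inv_word_cat (X : Type) (u v : invword X) :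
  inv_word (u ++ v) = inv_word v ++ inv_word u.
Proof. by rewrite /inv_word map_cat rev_cat. Qed.

Section Eval.
Variables (X : Type) (M : inverseMonoidType) (i : X -> M).

Definition eval_letter (a : X + X) : M :=
  match a with inl x => i x | inr x => (i x)^-1 end.

Definition eval_word (w : invword X) : M := \big[*%g/1]_(a <- w) eval_letter a.

Lemma eval_word_cat u v : eval_word (u ++ v) = eval_word u * eval_word v.
Proof. exact: big_cat. Qed.

Lemma eval_word_inv w : eval_word (inv_word w) = (eval_word w)^-1.
Proof.
elim: w => [|a w IH]; first by rewrite /eval_word big_nil invg1.
rewrite -cat1s inv_word_cat !eval_word_cat invgM IH; congr (_ * _).
by rewrite /eval_word /= !big_seq1; case: a => x //=; rewrite invgK.
Qed.

End Eval.

Lemma eval_word_surjective (X : Type) (M : inverseMonoidType) (i : X -> M) :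
  generates (range i) -> forall g, exists w, eval_word i w = g.
Proof.
move=> gen g; have [] // : range (eval_word i) g; last by move=> w _ <-; exists w.
rewrite (gen (range (eval_word i))) //; last first.
  by move=> _ [x _ <-]; exists [:: inl x]; rewrite // /eval_word big_seq1.
split=> [|_ _ [u _ <-] [v _ <-]|_ [u _ <-]].
- by exists [::]; rewrite // /eval_word big_nil.
- by exists (u ++ v); rewrite // eval_word_cat.
- by exists (inv_word u); rewrite // eval_word_inv.
Qed.

(* The congruence on words generated by the Vagner relations
   u u^-1 u ~ u and u u^-1 v v^-1 ~ v v^-1 u u^-1. *)
Inductive vagner (X : Type) : invword X -> invword X -> Prop :=
| vagner_refl u : vagner u u
| vagner_sym u v : vagner u v -> vagner v u
| vagner_trans u v w : vagner u v -> vagner v w -> vagner u w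
| vagner_cat u u' v v' : vagner u u' -> vagner v v' -> vagner (u ++ v) (u' ++ v')
| vagner_regular u : vagner (u ++ inv_word u ++ u) u
| vagner_comm u v :
    vagner ((u ++ inv_word u) ++ (v ++ inv_word v))
           ((v ++ inv_word v) ++ (u ++ inv_word u)).

Lemma vagner_inv (X : Type) (u v : invword X) :
  vagner u v -> vagner (inv_word u) (inv_word v).
Proof.
elim=> {u v} [u|u v _ H|u v w _ H1 _ H2|u u' v v' _ H1 _ H2|u|u v].
- exact: vagner_refl.
- exact: vagner_sym.
- exact: vagner_trans H1 H2.
- by rewrite !inv_word_cat; exact: vagner_cat.
- rewrite !inv_word_cat -catA inv_wordK.
  by have := vagner_regular (inv_word u); rewrite inv_wordK.
- by rewrite !inv_word_cat !inv_wordK; exact: vagner_comm.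
Qed.

Lemma vagner_eval (X : Type) (M : inverseMonoidType) (i : X -> M) u v :
  vagner u v -> eval_word i u = eval_word i v.
Proof.
have idemC (x y : M) : x * x^-1 * (y * y^-1) = y * y^-1 * (x * x^-1).
  have idV (z : M) : z * z^-1 * (z * z^-1) = z * z^-1 by rewrite mulgA mulgVgK.
  have idM : x * x^-1 * (y * y^-1) * (x * x^-1 * (y * y^-1))
             = x * x^-1 * (y * y^-1).
    set e := x * x^-1; set f := y * y^-1.
    have eV : e^-1 = e by rewrite /e invgM invgK.
    have fV : f^-1 = f by rewrite /f invgM invgK.
    have H := mulgVgK (e * f); rewrite invgM eV fV in H.
    move: H.
    have -> : e * f * (f * e) * (e * f) = e * (f * f) * (e * e) * f.
      by rewrite !mulgA.
    by rewrite !idV !mulgA.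
  have -> : x * x^-1 * (y * y^-1) = (x * x^-1 * (y * y^-1))^-1.
    by apply: invg_unique; rewrite !idM.
  by rewrite invgM !invgM !invgK.
elim=> {u v} [//|//|||u|u v].
- by move=> u v w _ -> _ ->.
- by move=> u u' v v' _ H1 _ H2; rewrite !eval_word_cat H1 H2.
- by rewrite !eval_word_cat eval_word_inv mulgA mulgVgK.
- by rewrite !eval_word_cat !eval_word_inv idemC.
Qed.

Section FreeInverseMonoid.
Variable X : choiceType.

Definition vagnerb (u v : invword X) : bool := `[< vagner u v >].

Lemma vagnerb_refl : reflexive vagnerb.
Proof. by move=> u; apply/asboolP/vagner_refl. Qed.

Lemma vagnerb_sym : symmetric vagnerb.
Proof. by move=> u v; apply/asboolP/asboolP; exact: vagner_sym. Qed.

Lemma vagnerb_trans : transitive vagnerb.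
Proof.
by move=> v u w /asboolP uv /asboolP vw; apply/asboolP/(vagner_trans uv vw).
Qed.

Canonical vagner_equiv := EquivRel vagnerb vagnerb_refl vagnerb_sym vagnerb_trans.

Definition FIM : Type := {eq_quot vagner_equiv}.
HB.instance Definition _ := Choice.on FIM.
HB.instance Definition _ := EqQuotient.on FIM.

Implicit Types (u v w : invword X) (g h : FIM).

Lemma fim_eqP u v : reflect (\pi_FIM u = \pi_FIM v) `[< vagner u v >].
Proof. exact: eqmodP. Qed.

Lemma fim_repr u : vagner (repr (\pi_FIM u)) u.
Proof. by apply/asboolP/fim_eqP; rewrite reprK. Qed.

Lemma fim_ind (P : FIM -> Prop) : (forall u, P (\pi_FIM u)) -> forall g, P g.
Proof. by move=> Pu g; rewrite -[g]reprK. Qed.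

Definition fim_mul g h : FIM := \pi_FIM (repr g ++ repr h).
Definition fim_one : FIM := \pi_FIM [::].
Definition fim_inv g : FIM := \pi_FIM (inv_word (repr g)).

Lemma fim_mulE u v : fim_mul (\pi_FIM u) (\pi_FIM v) = \pi_FIM (u ++ v).
Proof. by apply/fim_eqP/asboolP/vagner_cat; exact: fim_repr. Qed.

Lemma fim_invE u : fim_inv (\pi_FIM u) = \pi_FIM (inv_word u).
Proof. by apply/fim_eqP/asboolP/vagner_inv; exact: fim_repr. Qed.

Lemma fim_mulA : associative fim_mul.
Proof.
elim/fim_ind=> u; elim/fim_ind=> v; elim/fim_ind=> w.
by rewrite !fim_mulE catA.
Qed.

Lemma fim_mul1 : left_id fim_one fim_mul.
Proof. by elim/fim_ind=> u; rewrite fim_mulE. Qed.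

Lemma fim_invK : involutive fim_inv.
Proof. by elim/fim_ind=> u; rewrite !fim_invE inv_wordK. Qed.

Lemma fim_invM : {morph fim_inv : g h / fim_mul g h >-> fim_mul h g}.
Proof.
by elim/fim_ind=> u; elim/fim_ind=> v; rewrite !(fim_mulE, fim_invE) inv_word_cat.
Qed.

HB.instance Definition _ :=
  isStarMonoid.Build FIM fim_mulA fim_mul1 fim_invK fim_invM.

Lemma fim_mulgVgK g : g * g^-1 * g = g.
Proof.
elim/fim_ind: g => u; rewrite -mulgA; change (fim_mul (\pi_FIM u)
  (fim_mul (fim_inv (\pi_FIM u)) (\pi_FIM u)) = \pi_FIM u).
by rewrite fim_invE !fim_mulE; apply/fim_eqP/asboolP/vagner_regular.
Qed.

Lemma fim_idemC g h : g * g^-1 * (h * h^-1) = h * h^-1 * (g * g^-1).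
Proof.
rewrite -[g]reprK -[h]reprK; move: (repr g) (repr h) => u v.
change (fim_mul (fim_mul (\pi_FIM u) (fim_inv (\pi_FIM u)))
                (fim_mul (\pi_FIM v) (fim_inv (\pi_FIM v))) =
        fim_mul (fim_mul (\pi_FIM v) (fim_inv (\pi_FIM v)))
                (fim_mul (\pi_FIM u) (fim_inv (\pi_FIM u)))).
by rewrite !fim_invE !fim_mulE; apply/fim_eqP/asboolP/vagner_comm.
Qed.

Lemma fim_invg_unique g h : g * h * g = g -> h * g * h = h -> h = g^-1.
Proof.
have VgK (x : FIM) : x^-1 * x * x^-1 = x^-1.
  by rewrite -{2}(invgK x) fim_mulgVgK.
have idem_sa (e : FIM) : e * e = e -> e^-1 = e.
  move=> ee; have eVV : e^-1 * e^-1 = e^-1 by rewrite -invgM ee.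
  have H : e = e^-1 * e * (e * e^-1).
    have := fim_idemC e e^-1; rewrite invgK => <-.
    have -> : e * e^-1 * (e^-1 * e) = e * (e^-1 * e^-1) * e by rewrite !mulgA.
    by rewrite eVV fim_mulgVgK.
  suff eV : e = e^-1 by rewrite -eV.
  rewrite {1}H.
  have -> : e^-1 * e * (e * e^-1) = e^-1 * (e * e) * e^-1 by rewrite !mulgA.
  by rewrite ee VgK.
have idemC (e f : FIM) : e * e = e -> f * f = f -> e * f = f * e.
  move=> ee ff; have := fim_idemC e f.
  by rewrite (idem_sa e ee) (idem_sa f ff) ee ff.
move=> ghg hgh.
have gh2 : g * h * (g * h) = g * h by rewrite mulgA ghg.
have hg2 : h * g * (h * g) = h * g by rewrite mulgA hgh.
have gV2 : g * g^-1 * (g * g^-1) = g * g^-1 by rewrite mulgA fim_mulgVgK.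
have Vg2 : g^-1 * g * (g^-1 * g) = g^-1 * g by rewrite mulgA VgK.
have -> : h = h * g * g^-1.
  rewrite -{1}hgh -{1}(fim_mulgVgK g).
  have -> : h * (g * g^-1 * g) * h = h * (g * g^-1 * (g * h)) by rewrite !mulgA.
  by rewrite (idemC _ _ gV2 gh2) !mulgA hgh.
rewrite -[RHS]VgK -[X in _ = _ * X * _]ghg.
have -> : g^-1 * (g * h * g) * g^-1 = g^-1 * g * (h * g) * g^-1.
  by rewrite !mulgA.
by rewrite (idemC _ _ Vg2 hg2) -!mulgA (mulgA g^-1 g g^-1) VgK.
Qed.

HB.instance Definition _ :=
  StarMonoid_isInverseMonoid.Build FIM fim_mulgVgK fim_invg_unique.

Definition fim_gen (x : X) : FIM := \pi_FIM [:: inl x].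

Lemma eval_fim_gen u : eval_word fim_gen u = \pi_FIM u.
Proof.
elim: u => [|a u IH]; first by rewrite /eval_word big_nil.
rewrite -cat1s eval_word_cat IH /eval_word big_seq1; case: a => x /=.
  exact: fim_mulE.
by rewrite [(fim_gen x)^-1]fim_invE; exact: fim_mulE.
Qed.

Lemma fim_generates : generates (range fim_gen).
Proof.
move=> S [S1 SM SV] genS; apply/seteqP; split=> // g _.
rewrite -[g]reprK -eval_fim_gen; elim: (repr g) => [|a u IH].
  by rewrite /eval_word big_nil.
rewrite -cat1s eval_word_cat; apply: SM => //; rewrite /eval_word big_seq1.
by case: a => x /=; [|apply: SV]; apply: genS; exists x.
Qed.

Section Lift.
Variables (M : inverseMonoidType) (i : X -> M).

(* The canonical homomorphism FIM X -> M extending i. *)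
Definition fim_lift (g : FIM) : M := eval_word i (repr g).

Lemma fim_lift_pi u : fim_lift (\pi_FIM u) = eval_word i u.
Proof. exact/vagner_eval/fim_repr. Qed.

Lemma fim_lift_gen x : fim_lift (fim_gen x) = i x.
Proof. by rewrite fim_lift_pi /eval_word big_seq1. Qed.

Lemma fim_lift_monoid_morphism : monoid_morphism fim_lift.
Proof.
split=> [|g h]; first by rewrite fim_lift_pi /eval_word big_nil.
by rewrite -[g]reprK -[h]reprK [_ * _]fim_mulE !fim_lift_pi eval_word_cat.
Qed.

HB.instance Definition _ :=
  isUMagmaMorphism.Build FIM M fim_lift fim_lift_monoid_morphism.

Lemma fim_lift_unique (f : FIM -> M) : monoid_morphism f ->
  (forall x, f (fim_gen x) = i x) -> f =1 fim_lift.
Proof.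
move=> [f1 fM] fgen g.
have fV h : f h^-1 = (f h)^-1.
  apply: invg_unique; rewrite -!fM ?mulgVgK //.
  by rewrite -{2}(invgK h) mulgVgK.
rewrite -[g]reprK fim_lift_pi -eval_fim_gen.
elim: (repr g) => [|a u IH]; first by rewrite /eval_word !big_nil f1.
rewrite -cat1s !eval_word_cat fM IH; congr (_ * _).
by rewrite /eval_word !big_seq1; case: a => x /=; rewrite ?fV fgen.
Qed.

End Lift.

End FreeInverseMonoid.

Arguments fim_gen {X} x.

Section Growth.
Variables (X : Type) (M : inverseMonoidType) (i : X -> M).

(* [word_length g n]: n is the minimal length of a word representing g. *)
Definition word_length (g : M) (n : nat) : Prop :=
  (exists w, eval_word i w = g /\ size w = n) /\
  (forall w, eval_word i w = g -> (n <= size w)%N).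

Lemma word_length_inj g m n : word_length g m -> word_length g n -> m = n.
Proof.
move=> [[u [gu <-]] mu] [[v [gv <-]] mv].
by apply/eqP; rewrite eqn_leq mu // mv.
Qed.

Lemma word_length_exists g :
  generates (range i) -> exists n, word_length g n.
Proof.
move=> /eval_word_surjective /(_ g) [w0 gw0].
pose P n := `[< exists w, eval_word i w = g /\ size w = n >].
have exP : exists n, P n by exists (size w0); apply/asboolP; exists w0.
case: (ex_minnP exP) => n /asboolP ? min_n; exists n; split=> // w gw.
by apply: min_n; apply/asboolP; exists w.
Qed.

Definition sphere (n : nat) : set M := [set g | word_length g n].

(* [fset_set] is the empty set on infinite sets; see [finite_sphere]. *)
Definition growth (n : nat) : nat := #|` fset_set (sphere n)|.

Definition growth_rate (R : realType) : \bar R :=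
  limn_esup (fun n => ((growth n)%:R `^ (n%:R^-1))%R%:E).

End Growth.

Lemma finite_sphere (X : finType) (M : inverseMonoidType) (i : X -> M) n :
  finite_set (sphere i n).
Proof.
have /sub_finite_set : sphere i n `<=`
    (fun t : n.-tuple (X + X)%type => eval_word i t) @` setT.
  move=> g [[w [gw /eqP sw]] _]; exists (Tuple sw) => //.
by apply; apply/finite_image/finite_finset.
Qed.

(* Main.v *)
From HB Require Import structures.
Require Import Defs.
From mathcomp Require Import all_boot all_order all_algebra.
From mathcomp Require Import finmap zify ring lra.
From mathcomp Require Import all_classical all_reals all_analysis.

(** The elements of the free inverse monoid on X are the pairs (T, g) of a
    finite subtree T of the Cayley tree of the free group on X with 1 in T and
    a vertex g of T; a word w gives the set T of vertices visited when w is read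
    from 1 ([munn]) and the end point g ([munn_vagner]).  The length of (T, g)
    is 2(|T| - 1) - |g| ([cost_munn], [tree_word]), because a shortest walk
    crosses the edges of the path from 1 to g, the trunk, once and all other
    edges twice.

    The inequality holds because a geodesic word of M is also geodesic in
    FIM_X ([growth_lift]).  For the strict inequality, let r be the growth rate
    of FIM_X and z = 1/r.  Cutting (T, g) along its trunk shows it as a sequence
    of decorations, one tree for each trunk vertex, and so the sum of z^length
    over all (T, g) is computed by the powers of a transfer matrix whose entries
    are sums of z^length over decorations ([munn_sum_split_ge],
    [munn_sum_split_le]).  These powers stay bounded: a diagonal entry larger
    than 1 would by supermultiplicativity make FIM_X grow faster than r
    ([transfer_pow_diag_le1]).

    Suppose now that FIM_X -> M identifies two elements.  Then it identifies
    two idempotents with nested distinct trees, and these can be translated deep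
    into the cone of any letter d.  Hence for each d there is a decoration,
    with all its vertices in the cone of d, whose loop has a shorter word in M
    ([shortcut_exists]); no geodesic word of M can carry it on its trunk
    ([geodesic_trunk_avoids]).  Forbidding it multiplies every entry of the
    transfer matrix by at most some theta < 1 ([decoration_sum_bad_le]), so the
    series of the growth of M converges at z ([ball_bounded]).  If M also had
    growth rate r, then submultiplicativity of its growth would
    give at least r^n elements of length n for every n > 0
    ([root_rate_submul]), and the series would diverge.  The partial sums are
    taken over trees with at most n vertices, with bounds independent of n, so
    that only finite sums occur. *)

Set Implicit Arguments.
Unset Strict Implicit.
Unset Printing Implicit Defensive.
Import Order.TTheory GRing.Theory Num.Theory.

(** * Range idempotents of an inverse monoid *)

Section RangeIdempotent.
Local Open Scope group_scope.
Variable M : inverseMonoidType.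
Implicit Types x y z : M.

Definition ran x := x * x^-1.

(** Commutation is one of the Vagner relations, read in M. *)
Lemma ranC x y : ran x * ran y = ran y * ran x.
Proof.
have := vagner_eval (fun x : M => x) (vagner_comm [:: inl x] [:: inl y]).
by rewrite /eval_word !big_cat /= !big_seq1 /= !mulgA.
Qed.

Lemma ran_mulK x : ran x * x = x.
Proof. exact: mulgVgK. Qed.

Lemma ran_idem x : ran x * ran x = ran x.
Proof. by rewrite {2}/ran mulgA ran_mulK. Qed.

Lemma ranM x y : ran (x * y) = x * ran y * x^-1.
Proof. by rewrite /ran invgM !mulgA. Qed.

(** A range idempotent moves across a factor on its left, because y y^-1 commutes
    with x^-1 x. *)
Lemma mul_ran x y : x * ran y = ran (x * y) * x.
Proof.
have E : ran x^-1 = x^-1 * x by rewrite /ran invgK.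
rewrite ranM -(mulgA _ _ x) -E -(mulgA x) ranC [RHS]mulgA.
by rewrite E (mulgA x x^-1 x) mulgVgK.
Qed.

(** The statement [ran y * z = z] says that z lies below y in the range order;
    this order is compatible with translation by x^-1. *)
Lemma ran_lid_inv x y z : ran (x * y) * z = z -> ran y * (x^-1 * z) = x^-1 * z.
Proof.
have A r : ran y * (x^-1 * (r * z)) = ran y * (x^-1 * r) * z by rewrite !mulgA.
have B r : x^-1 * (r * z) = x^-1 * r * z by rewrite mulgA.
move=> E; rewrite -E A B mul_ran; congr (_ * z).
rewrite (mulgA (ran y)); congr (_ * x^-1); rewrite (mulgA x^-1).
have Ee : ran x^-1 = x^-1 * x by rewrite /ran invgK.
have eV : (x^-1 * x)^-1 = x^-1 * x by rewrite invgM invgK.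
rewrite ranM eV -Ee -(mulgA (ran x^-1)) (ranC y) (mulgA (ran x^-1)) ran_idem.
by rewrite (ranC x^-1) (mulgA (ran y)) ran_idem.
Qed.

End RangeIdempotent.

(** * Munn trees *)

Section FsetImage.
Local Open Scope fset_scope.
Variables (T K : choiceType) (f : T -> K).

Lemma fimsetP (A : {fset T}) k : reflect (exists2 x, x \in A & k = f x) (k \in f @` A).
Proof. exact: imfsetP. Qed.

Lemma mem_fimset (A : {fset T}) x : x \in A -> f x \in f @` A.
Proof. by move=> xA; apply/fimsetP; exists x. Qed.

End FsetImage.

Section Munn.
Variable X : choiceType.
Local Notation L := (X + X)%type.
Implicit Types (a b c : L) (s t : seq L) (u v w : invword X).

Definition reduced s := sorted (fun a b => b != inv_letter a) s.

(** Left multiplication by a letter in the free group, on reduced words. *)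
Definition lmul a s :=
  if s is b :: s' then if b == inv_letter a then s' else a :: s else [:: a].

Definition act w s := foldr lmul s w.

(** Vertices of the Cayley tree are reduced words, read from the root 1.  The walk
    of a :: w first goes to a and then follows the walk of w translated by a. *)
Definition munn w : {fset seq L} :=
  foldr (fun a T => [::] |` (lmul a @` T))%fset [fset [::]]%fset w.

Arguments munn : simpl never.

Lemma inv_letter_neq a : inv_letter a != a.
Proof. by case: a. Qed.

Lemma reduced_cons a s :
  reduced (a :: s) = (ohead s != Some (inv_letter a)) && reduced s.
Proof. by case: s => [|b s] //=. Qed.

Lemma reduced_behead a s : reduced (a :: s) -> reduced s.
Proof. by rewrite reduced_cons => /andP[]. Qed.

Lemma lmul_cons a s : ohead s != Some (inv_letter a) -> lmul a s = a :: s.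
Proof.
case: s => [|b s] //= H; case: eqP => // E; by rewrite E eqxx in H.
Qed.

Lemma lmul_inv a s : lmul a (inv_letter a :: s) = s.
Proof. by rewrite /= eqxx. Qed.

Variant lmul_spec a s : seq L -> Prop :=
| LmulCons of ohead s != Some (inv_letter a) : lmul_spec a s (a :: s)
| LmulInv s' of s = inv_letter a :: s' : lmul_spec a s s'.

Lemma lmulP a s : lmul_spec a s (lmul a s).
Proof.
have [E|N] := eqVneq (ohead s) (Some (inv_letter a)); last first.
  by rewrite lmul_cons //; left.
by case: s E => [//|b s] [->]; rewrite lmul_inv; right.
Qed.

Lemma lmul_reduced a s : reduced s -> reduced (lmul a s).
Proof.
case: lmulP => [H|s' ->] R; first by rewrite reduced_cons H.
exact: reduced_behead R.
Qed.

Lemma lmulVK a s : reduced s -> lmul (inv_letter a) (lmul a s) = s.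
Proof.
case: (lmulP a s) => [H _|s' -> R]; first by rewrite -{2}(inv_letterK a) lmul_inv.
by rewrite lmul_cons // inv_letterK; move: R; rewrite reduced_cons inv_letterK => /andP[].
Qed.

Lemma act_reduced w s : reduced s -> reduced (act w s).
Proof. by move=> R; elim: w => //= a w; exact: lmul_reduced. Qed.

Lemma act_cat u v s : act (u ++ v) s = act u (act v s).
Proof. exact: foldr_cat. Qed.

Lemma actVK w s : reduced s -> act (inv_word w) (act w s) = s.
Proof.
move=> R; elim: w => [//|a w IH].
by rewrite -cat1s inv_word_cat act_cat /= lmulVK // act_reduced.
Qed.

Lemma actKV w s : reduced s -> act w (act (inv_word w) s) = s.
Proof. by move=> R; rewrite -{1}(inv_wordK w) actVK. Qed.

Lemma act_inj w s t : reduced s -> reduced t -> act w s = act w t -> s = t.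
Proof. by move=> Rs Rt E; rewrite -(actVK w Rs) E actVK. Qed.

Lemma size_act w s : size (act w s) <= size w + size s.
Proof.
elim: w => [|a w IH] /=; first exact: leqnn.
by case: lmulP => [_|s' E] /=; rewrite ?E /= in IH *; lia.
Qed.

Lemma act_cat_reduced s t : reduced (s ++ t) -> act s t = s ++ t.
Proof.
elim: s => [//|a s IH] /[dup] R; rewrite cat_cons reduced_cons => /andP[H R'].
by rewrite /= IH // lmul_cons.
Qed.

Lemma act_lmul a s t : reduced s -> reduced t -> act (lmul a s) t = lmul a (act s t).
Proof.
move=> Rs Rt; case: (lmulP a s) => // s' E; rewrite E in Rs *.
have Rs' := reduced_behead Rs; by rewrite -{1}(inv_letterK a) /= lmulVK // act_reduced.
Qed.

Lemma act_nil w t : reduced t -> act (act w [::]) t = act w t.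
Proof.
move=> R; elim: w => [//|a w IH]; by rewrite /= act_lmul ?act_reduced ?IH.
Qed.

Lemma mem_munn0 s : (s \in munn [::]) = (s == [::]).
Proof. by rewrite inE. Qed.

Lemma mem_munn_cons a w s :
  (s \in munn (a :: w)) = (s == [::]) || (s \in lmul a @` munn w)%fset.
Proof. by rewrite !inE. Qed.

Lemma munn_reduced w s : s \in munn w -> reduced s.
Proof.
elim: w s => [|a w IH] s; first by rewrite mem_munn0 => /eqP->.
by rewrite mem_munn_cons => /orP[/eqP->//|/fimsetP[t /IH R ->]]; exact: lmul_reduced.
Qed.

Lemma munn_nil w : [::] \in munn w.
Proof. by case: w => [|a w]; rewrite ?mem_munn0 ?mem_munn_cons. Qed.

Lemma act_munn w : act w [::] \in munn w.
Proof.
elim: w => [|a w IH]; first by rewrite mem_munn0.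
by rewrite mem_munn_cons /= mem_fimset ?orbT.
Qed.

Lemma mem_munn_cat u v s :
  (s \in munn (u ++ v)) = (s \in munn u) || (s \in act u @` munn v)%fset.
Proof.
elim: u s => [|a u IH] s.
  have -> : (act [::] @` munn v)%fset = munn v by exact: imfset_id.
  by rewrite mem_munn0; case: eqP => //= ->; exact: munn_nil.
rewrite cat_cons !mem_munn_cons -orbA; congr (_ || _).
apply/fimsetP/orP => [[t]|].
  rewrite IH => /orP[H|/fimsetP[r H ->]] ->; [left|right]; apply/fimsetP.
    by exists t.
  by exists r.
case=> /fimsetP[t H ->]; first by exists t => //; rewrite IH H.
by exists (act u t) => //; rewrite IH mem_fimset ?orbT.
Qed.

Lemma mem_munn1 a s : (s \in munn [:: a]) = (s == [::]) || (s == [:: a]).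
Proof. by rewrite mem_munn_cons imfset_fset1 !inE. Qed.

Lemma act_imfset_munnV w : (act w @` munn (inv_word w))%fset = munn w.
Proof.
elim: w => [|a w IH]; first exact: imfset_id.
apply/fsetP=> s; rewrite -cat1s inv_word_cat cat1s mem_munn_cons -IH.
apply/fimsetP/orP => [[t]|].
  rewrite mem_munn_cat => /orP[H|/fimsetP[r + ->]] ->.
    by right; do 2 apply: mem_fimset.
  rewrite mem_munn1 => /orP[/eqP->|/eqP->].
    by right; rewrite /= actKV //; apply/fimsetP; exists [::] => //; rewrite IH munn_nil.
  by left; rewrite /= actKV //= eqxx.
case=> [/eqP->|/fimsetP[_ /fimsetP[r H ->] ->]].
  exists (act (inv_word w) [:: inv_letter a]); last by rewrite /= actKV //= eqxx.
  rewrite mem_munn_cat mem_fimset ?orbT // mem_munn1 eqxx.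
  by rewrite orbT.
by exists r => //; rewrite mem_munn_cat H.
Qed.

Lemma mem_munnVV w s : (s \in munn (w ++ inv_word w)) = (s \in munn w).
Proof. by rewrite mem_munn_cat act_imfset_munnV orbb. Qed.

Lemma act_munnVV w s : reduced s -> act (w ++ inv_word w) s = s.
Proof. by move=> R; rewrite act_cat actKV. Qed.

Lemma mem_munnVV_cat w u s :
  (s \in munn ((w ++ inv_word w) ++ u)) = (s \in munn w) || (s \in munn u).
Proof.
rewrite mem_munn_cat mem_munnVV; congr (_ || _).
apply/fimsetP/idP => [[t H ->]|H].
  by rewrite act_munnVV ?(munn_reduced H).
by exists s; rewrite ?act_munnVV ?(munn_reduced H).
Qed.

Lemma vagner_munn u v : vagner u v ->
  (forall s, reduced s -> act u s = act v s) /\ munn u = munn v.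
Proof.
elim=> {u v} [u|u v _ [Ha Hm]|u v w _ [Ha Hm] _ [Ha' Hm']|u u' v v' _ [Ha Hm] _ [Ha' Hm']|u|u v].
- by [].
- by split=> // s R; rewrite Ha.
- by split=> [s R|]; rewrite ?Ha ?Ha' ?Hm.
- split=> [s R|]; first by rewrite !act_cat Ha' // Ha // act_reduced.
  apply/fsetP=> s; rewrite !mem_munn_cat Hm Hm'; congr (_ || _).
  apply/fimsetP/fimsetP => -[t H ->]; exists t => //; rewrite ?Ha //;
    exact: munn_reduced H.
- split=> [s R|]; first by rewrite !act_cat actKV // act_reduced.
  by apply/fsetP=> s; rewrite catA mem_munnVV_cat orbb.
- split=> [s R|]; first by rewrite !(act_cat (_ ++ _)) !act_munnVV.
  by apply/fsetP=> s; rewrite !mem_munnVV_cat !mem_munnVV orbC.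
Qed.

Section Eval.
Local Open Scope group_scope.
Variables (M : inverseMonoidType) (i : X -> M).
Local Notation ev := (eval_word i).

Lemma eval_cons a w : ev (a :: w) = eval_letter i a * ev w.
Proof. by rewrite /eval_word big_cons. Qed.

Lemma eval_nil : ev [::] = 1.
Proof. by rewrite /eval_word big_nil. Qed.

Lemma eval_letterV a : eval_letter i (inv_letter a) = (eval_letter i a)^-1.
Proof. by case: a => x //=; rewrite invgK. Qed.

(** If a prefix of w reduces to t, its value lies below that of t in the natural
    order, because cancelling a factor a a^-1 deletes an idempotent. *)
Lemma munn_ran_id w t : t \in munn w -> ran (ev t) * ev w = ev w.
Proof.
elim: w t => [|a w IH] t.
  by rewrite mem_munn0 => /eqP->; rewrite eval_nil /ran invg1 !mulg1.
rewrite mem_munn_cons => /orP[/eqP->|/fimsetP[s /IH Es ->]].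
  by rewrite eval_nil /ran invg1 !mul1g.
rewrite eval_cons; case: lmulP => [_|s' E].
  by rewrite eval_cons mulgA -mul_ran -mulgA Es.
move: Es; rewrite E eval_cons eval_letterV.
set x := eval_letter i a; set y := ev s' => Es.
have E1 : ran y * x = x * ran (x^-1 * y).
  rewrite ranM invgK.
  have -> : x * (x^-1 * ran y * x) = ran x * ran y * x by rewrite /ran !mulgA.
  by rewrite (ranC x y) -(mulgA (ran y)) ran_mulK.
by rewrite mulgA E1 -mulgA Es.
Qed.

(** Together with [munn_ran_id]: the range idempotent of w is the meet of the range
    idempotents of the vertices of its tree, and so depends on the tree only. *)
Lemma munn_ran_meet w y :
  (forall t, t \in munn w -> ran (ev t) * y = y) -> ran (ev w) * y = y.
Proof.
elim: w y => [|a w IH] y H; first by apply: H; exact: munn_nil.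
set x := eval_letter i a.
have Hx : x * (x^-1 * y) = y.
  have := H [:: a]; rewrite eval_cons eval_nil mulg1 /ran -mulgA; apply.
  rewrite mem_munn_cons; apply/fimsetP; exists [::] => //; exact: munn_nil.
have E : ran (ev w) * (x^-1 * y) = x^-1 * y.
  apply: IH => s Hs; have Ht : lmul a s \in munn (a :: w).
    by rewrite mem_munn_cons mem_fimset ?orbT.
  have := H _ Ht; case: lmulP => [_|t ->].
    rewrite eval_cons -/x; exact: ran_lid_inv.
  move=> Et; rewrite eval_cons eval_letterV -/x mulgA -mul_ran -mulgA Et //.
by rewrite eval_cons -/x ranM -(mulgA _ x^-1) -(mulgA x) E.
Qed.

Lemma munn_sub_ran u w : {subset munn u <= munn w} ->
  ran (ev u) * ran (ev w) = ran (ev w).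
Proof.
move=> H; apply: munn_ran_meet => t /H/munn_ran_id E.
by rewrite {2}/ran mulgA E.
Qed.

Lemma munn_ran u w : munn u = munn w -> ran (ev u) = ran (ev w).
Proof.
move=> E; rewrite -[RHS](@munn_sub_ran u) ?E // ranC munn_sub_ran ?E //.
Qed.

(** Reduction of w only deletes idempotents, all of which are above the range
    idempotent of w. *)
Lemma eval_act w : ev w = ran (ev w) * ev (act w [::]).
Proof.
elim: w => [|a w IH] /=; first by rewrite eval_nil /ran invg1 !mulg1.
rewrite eval_cons; set x := eval_letter i a; set g := act w [::] in IH *.
rewrite {1}IH mulgA; case: lmulP => [_|g' E].
  by rewrite mul_ran -mulgA eval_cons.
by rewrite E eval_cons eval_letterV -/x ranM !mulgA.
Qed.

(** The tree gives the range idempotent of the value and the end point gives the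
    rest.  In the free inverse monoid this is one half of Munn's theorem. *)
Lemma munn_eval u w : munn u = munn w -> act u [::] = act w [::] -> ev u = ev w.
Proof. by move=> /munn_ran E Ea; rewrite eval_act Ea E -eval_act. Qed.

End Eval.

Lemma munn_vagner u v : (\pi_(FIM X) u = \pi_(FIM X) v)%qT <->
  munn u = munn v /\ act u [::] = act v [::].
Proof.
split=> [/fim_eqP/asboolP/vagner_munn[H ->]|[E1 E2]]; first by rewrite H.
by rewrite -!eval_fim_gen; exact: munn_eval.
Qed.

End Munn.

Arguments munn : simpl never.

(** * Finite subtrees and geodesic words *)

Section Trees.
Variable X : choiceType.
Local Notation L := (X + X)%type.
Local Open Scope fset_scope.
Local Open Scope nat_scope.
Implicit Types (a b c : L) (s t g : seq L) (u v w : invword X).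
Implicit Types (T D S : {fset seq L}).

(** Finite connected sets of vertices that contain the root. *)
Definition is_tree T := [/\ [::] \in T, forall s t, s ++ t \in T -> s \in T
  & forall s, s \in T -> reduced s].

(** The length of (T, g) in the free inverse monoid: a shortest walk through T
    from the root to g crosses the edges of the path to g once, the others twice. *)
Definition cost T g := 2 * #|` T|.-1 - size g.

Definition branch c T := [fset behead s | s in [fset s in T | ohead s == Some c]].
Definition rest c T := [fset s in T | ohead s != Some c].

(** The root of S becomes the neighbour c of the root of D. *)
Definition graft c D S := D `|` (cons c @` S).

Lemma mem_branch c T s : (s \in branch c T) = (c :: s \in T).
Proof.
apply/fimsetP/idP => [[t]|H]; last by exists (c :: s); rewrite // !inE H /= eqxx.
by rewrite !inE => /andP[H /eqP]; case: t H => //= b t H [E] ->; rewrite -E.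
Qed.

Lemma mem_rest c T s : (s \in rest c T) = (s \in T) && (ohead s != Some c).
Proof. by rewrite !inE. Qed.

Lemma mem_graft c D S s :
  (s \in graft c D S) = (s \in D) || (if s is b :: s' then (b == c) && (s' \in S) else false).
Proof.
rewrite !inE; congr (_ || _); apply/fimsetP/idP => [[t H ->]|]; first by rewrite eqxx.
by case: s => // b s /andP[/eqP-> H]; exists s.
Qed.

Lemma graft_split c T : graft c (rest c T) (branch c T) = T.
Proof.
apply/fsetP=> -[|b s]; rewrite mem_graft mem_rest ?andbT ?orbF // mem_branch /=.
by have [->|/eqP H] := eqVneq b c; rewrite ?eqxx ?andbF ?orbF //= ?andbT //;
  case: eqP => [[]|]; rewrite ?andbT.
Qed.

Lemma is_tree_head T c s : is_tree T -> c :: s \in T -> [:: c] \in T.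
Proof. by move=> [_ H _]; exact: (H [:: c]). Qed.

Lemma is_tree_ohead T c s : is_tree T -> [:: c] \notin T -> s \in T -> ohead s != Some c.
Proof.
move=> HT /negP H sT; apply/negP => /eqP E; apply: H.
by case: s sT E => //= b s sT [Eb]; rewrite Eb in sT; exact: is_tree_head sT.
Qed.

Lemma is_tree_rest c T : is_tree T -> is_tree (rest c T).
Proof.
move=> [T0 Tp Tr]; split=> [|s t|s]; rewrite ?mem_rest ?T0 //.
  by move=> /andP[/Tp ->]; case: s.
by case/andP=> /Tr.
Qed.

Lemma rest_avoid c T : [:: c] \notin rest c T.
Proof. by rewrite mem_rest /= eqxx andbF. Qed.

Lemma rest_avoid2 a c T : [:: a] \notin T -> [:: a] \notin rest c T.
Proof. by rewrite mem_rest => /negPf->. Qed.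

Lemma is_tree_branch c T : is_tree T -> [:: c] \in T -> is_tree (branch c T).
Proof.
move=> [T0 Tp Tr] Tc; split=> [|s t|s]; rewrite ?mem_branch //.
  by rewrite -cat_cons; exact: Tp.
by move/Tr/reduced_behead.
Qed.

Lemma branch_avoid c T : is_tree T -> [:: inv_letter c] \notin branch c T.
Proof.
by move=> [_ _ Tr]; rewrite mem_branch; apply/negP => /Tr; rewrite /reduced /= eqxx.
Qed.

Lemma is_tree_graft c D S : is_tree D -> is_tree S -> [:: inv_letter c] \notin S ->
  is_tree (graft c D S).
Proof.
move=> [D0 Dp Dr] HS Sc; have [S0 Sp Sr] := HS; split=> [|s t|s].
- by rewrite mem_graft D0.
- rewrite !mem_graft => /orP[/Dp ->//|]; case: s => [|b s]; rewrite ?D0 //=.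
  by case/andP=> -> /Sp ->; rewrite orbT.
- rewrite mem_graft => /orP[/Dr //|]; case: s => [//|b s] /andP[/eqP-> H].
  by rewrite reduced_cons Sr // (is_tree_ohead HS).
Qed.

Lemma rest_graft c D S : is_tree D -> [:: c] \notin D -> rest c (graft c D S) = D.
Proof.
move=> HD Dc; apply/fsetP=> s; rewrite mem_rest mem_graft.
case sD: (s \in D) => /=; first exact: is_tree_ohead sD.
by case: s {sD} => //= b s; rewrite -(inj_eq (@Some_inj _)); case: eqP; rewrite ?andbF.
Qed.

Lemma branch_graft c D S : is_tree D -> [:: c] \notin D -> branch c (graft c D S) = S.
Proof.
move=> HD Dc; apply/fsetP=> s; rewrite mem_branch mem_graft eqxx /=.
by case: (boolP (c :: s \in D)) => // /(is_tree_head HD); rewrite (negPf Dc).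
Qed.

Lemma card_graft c D S : is_tree D -> [:: c] \notin D ->
  #|` graft c D S| = #|` D| + #|` S|.
Proof.
move=> HD Dc; rewrite /graft cardfsU card_imfset /=; last by move=> s t [].
have -> : D `&` (cons c @` S) = fset0; last by rewrite cardfs0 subn0.
apply/fsetP=> s; rewrite in_fsetI in_fset0; apply/negP => /andP[+ /fimsetP[t _ E]].
by rewrite E => /(is_tree_head HD); rewrite (negPf Dc).
Qed.

Lemma card_split c T : is_tree T -> #|` T| = #|` rest c T| + #|` branch c T|.
Proof.
move=> HT; rewrite -{1}(graft_split c T) card_graft //; first exact: is_tree_rest.
exact: rest_avoid.
Qed.

Lemma card_tree_gt0 T : is_tree T -> 0 < #|` T|.
Proof. by case=> T0 _ _; rewrite cardfs_gt0; apply/fset0Pn; exists [::]. Qed.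

Lemma size_lt_card_tree T g : is_tree T -> g \in T -> size g < #|` T|.
Proof.
elim: g T => [|c g IH] T HT gT /=; first exact: card_tree_gt0.
have cT := is_tree_head HT gT.
have := IH _ (is_tree_branch HT cT); rewrite mem_branch => /(_ gT).
have := card_tree_gt0 (is_tree_rest c HT); rewrite (card_split c HT); lia.
Qed.

Lemma cost_split T c g : is_tree T -> c :: g \in T ->
  cost T (c :: g) = cost (rest c T) [::] + cost (branch c T) g + 1.
Proof.
move=> HT gT; have cT := is_tree_head HT gT.
have := size_lt_card_tree (g := g) (is_tree_branch HT cT); rewrite mem_branch => /(_ gT).
have := card_tree_gt0 (is_tree_rest c HT); rewrite /cost (card_split c HT) /=; lia.
Qed.

Lemma is_tree_munn w : is_tree (munn w).
Proof.
split; [exact: munn_nil| |exact: munn_reduced].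
elim: w => [|a w IH] s t; first by rewrite !mem_munn0; case: s.
rewrite !mem_munn_cons => /orP[|/fimsetP[r]]; first by case: s.
case: lmulP => [H rT E|r' -> rT E]; last first.
  apply/orP; right; apply/fimsetP; exists (inv_letter a :: s); rewrite ?lmul_inv //.
  by apply: (IH _ t); rewrite cat_cons E.
case: s E => [//|b s [-> E]]; rewrite -E in rT H; apply/orP; right.
apply/fimsetP; exists s; first exact: IH rT.
by rewrite lmul_cons //; case: (s) H.
Qed.

Lemma card_munn w : #|` munn w| <= (size w).+1.
Proof.
elim: w => [|a w IH]; first by rewrite cardfs1.
have -> : munn (a :: w) = [fset [::]] `|` (lmul a @` munn w) by [].
rewrite cardfsU cardfs1; apply: leq_trans (leq_subr _ _) _; rewrite add1n ltnS.
by apply: leq_trans IH; rewrite leq_imfset_card.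
Qed.

(** A letter put in front of w translates the tree.  If this adds a root, the path to
    the end point gets longer as well; otherwise the number of vertices stays and
    the length of the path changes by one.  In both cases the cost grows by at most 1. *)
Lemma cost_munn w : cost (munn w) (act w [::]) <= size w.
Proof.
elim: w => [|a w IH]; first by rewrite /cost cardfs1.
have := size_lt_card_tree (is_tree_munn w) (act_munn w).
have [H|H] := boolP ([:: inv_letter a] \in munn w).
  have E : munn (a :: w) = lmul a @` munn w.
    apply/fsetP=> s; rewrite mem_munn_cons; case: eqP => //= ->.
    by apply/esym/fimsetP; exists [:: inv_letter a]; rewrite ?lmul_inv.
  have : #|` munn (a :: w)| <= #|` munn w| by rewrite E leq_imfset_card.
  have : size (act w [::]) <= (size (act (a :: w) [::])).+1.
    by rewrite /=; case: lmulP => [_|s' ->] /=; lia.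
  move: IH; rewrite /cost /=; lia.
have : #|` munn (a :: w)| <= #|` munn w|.+1.
  have -> : munn (a :: w) = [fset [::]] `|` (lmul a @` munn w) by [].
  rewrite cardfsU cardfs1.
  have : #|` lmul a @` munn w| <= #|` munn w| by rewrite leq_imfset_card.
  lia.
have := is_tree_ohead (is_tree_munn w) H (act_munn w) => /lmul_cons /= ->.
move: IH; rewrite /cost /=; lia.
Qed.

Lemma act_loop w s : act w [::] = [::] -> reduced s -> act w s = s.
Proof. by move=> E R; rewrite -act_nil // E. Qed.

Lemma munn_loop_cat u v : act u [::] = [::] -> munn (u ++ v) = munn u `|` munn v.
Proof.
move=> E; apply/fsetP=> s; rewrite mem_munn_cat in_fsetU; congr (_ || _).
apply/fimsetP/idP => [[t H ->]|H]; first by rewrite (act_loop E) // (munn_reduced H).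
by exists s => //; rewrite (act_loop E) // (munn_reduced H).
Qed.

(** A loop followed by the letter c grafts the tree of what comes next at c. *)
Lemma munn_graft c u w : act u [::] = [::] -> [:: inv_letter c] \notin munn w ->
  munn (u ++ c :: w) = graft c (munn u) (munn w).
Proof.
move=> E H; rewrite munn_loop_cat //; apply/fsetP=> s.
rewrite [LHS]in_fsetU mem_munn_cons [RHS]in_fsetU.
have -> : lmul c @` munn w = cons c @` munn w.
  apply: eq_in_imfset => t tT; apply: lmul_cons.
  exact: is_tree_ohead (is_tree_munn w) H tT.
by case: eqP => //= ->; rewrite munn_nil.
Qed.

Lemma munn_return c w : act w [::] = [::] ->
  munn (c :: w ++ [:: inv_letter c]) = munn (c :: w).
Proof.
move=> E; apply/fsetP=> s; rewrite !mem_munn_cons munn_loop_cat // imfsetU in_fsetU.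
have [//|sN] := eqVneq s [::] => /=.
case: (boolP (s \in _)) => //= sw; apply/negP => /fimsetP[t].
rewrite mem_munn1 => /orP[]/eqP-> Es; last by rewrite Es lmul_inv eqxx in sN.
by rewrite Es mem_fimset ?munn_nil in sw.
Qed.

Lemma act_return c w : act w [::] = [::] -> act (c :: w ++ [:: inv_letter c]) [::] = [::].
Proof. by move=> E /=; rewrite act_cat /= act_loop //= eqxx. Qed.

(** Induction on |T|: for g = c g' walk around the part of T outside the cone of c
    and then enter the cone for good; for g = 1 enter some cone and come back. *)
Lemma tree_word T g : is_tree T -> g \in T ->
  exists w, [/\ munn w = T, act w [::] = g & size w = cost T g].
Proof.
move: {2}#|` T| (leqnn #|` T|) => n; elim: n T g => [|n IH] T g le HT gT.
  by have := card_tree_gt0 HT; lia.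
have split_word c h : [:: c] \in T -> c :: h \in T -> exists u v,
    [/\ munn u = rest c T, act u [::] = [::], munn v = branch c T &
      [/\ act v [::] = h, size u = cost (rest c T) [::] & size v = cost (branch c T) h]].
  move=> cT hT; have HR := is_tree_rest c HT; have HB := is_tree_branch HT cT.
  have := card_split c HT; have := card_tree_gt0 HR; have := card_tree_gt0 HB => B R E.
  have [||u [Mu Au Su]] := IH (rest c T) [::] _ HR; [lia|by case: HR|].
  have [||v [Mv Av Sv]] := IH (branch c T) h _ HB; [lia|by rewrite mem_branch|].
  by exists u, v.
case: g gT => [|c g] gT; last first.
  have cT := is_tree_head HT gT.
  have [u [v [Mu Au Mv [Av Su Sv]]]] := split_word c g cT gT; exists (u ++ c :: v); split.
  - by rewrite munn_graft // Mv ?Mu ?graft_split // branch_avoid.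
  - rewrite act_cat act_loop // ?act_reduced //= Av lmul_cons //.
    by case: HT => _ _ /(_ _ gT); rewrite reduced_cons => /andP[].
  - by rewrite size_cat /= Su Sv (cost_split HT) //; lia.
have [/existsP cT|] := boolP [exists c : T, ohead (val c) != None]; last first.
  rewrite negb_exists => /forallP nT; exists [::].
  have -> : T = [fset [::]].
    apply/fsetP=> s; rewrite inE; apply/idP/eqP => [sT|-> //].
    by have := nT [` sT]; rewrite /= negbK; case: (s).
  by rewrite /cost cardfs1.
have [c cT'] : exists c, [:: c] \in T.
  case: cT => -[[|c s] /= sT] // _; exists c; exact: is_tree_head sT.
have [u [v [Mu Au Mv [Av Su Sv]]]] := split_word c [::] cT' cT'.
exists (u ++ c :: v ++ [:: inv_letter c]); split.
- rewrite munn_loop_cat // munn_return // -munn_loop_cat // munn_graft // Mv ?Mu ?graft_split //.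
  exact: branch_avoid.
- by rewrite act_cat act_return.
- rewrite !size_cat /= size_cat Su Sv /= /cost /=.
  have := card_split c HT; have := card_tree_gt0 (is_tree_rest c HT).
  have := card_tree_gt0 (is_tree_branch HT cT').
  move: #|` branch c T| #|` rest c T| #|` T| => x y z; lia.
Qed.

End Trees.

(** * Shortcuts in a proper quotient *)

Section Shortcuts.
Variable X : choiceType.
Local Notation L := (X + X)%type.
Local Open Scope fset_scope.
Local Open Scope nat_scope.
Implicit Types (a b c d : L) (s t g : seq L) (u v w : invword X).
Implicit Types (T D S : {fset seq L}).

Lemma size_munn w s : s \in munn w -> size s <= size w.
Proof.
elim: w s => [|a w IH] s; first by rewrite mem_munn0 => /eqP->.
rewrite mem_munn_cons => /orP[/eqP->//|/fimsetP[t /IH H ->]].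
by case: lmulP => [_|t' E] /=; rewrite ?E /= in H *; lia.
Qed.

Lemma reduced_nseq a n : reduced (nseq n a).
Proof.
elim: n => [//|n IH]; rewrite -[nseq _ _]/(a :: nseq n a) reduced_cons IH andbT.
case: (n) => //= _.
by rewrite (inj_eq (@Some_inj _)) eq_sym inv_letter_neq.
Qed.

(** The letter a is only the value of [last] on the empty word. *)
Lemma reduced_cat s t a b : reduced s -> reduced (b :: t) ->
  b != inv_letter (last a s) -> reduced (s ++ b :: t).
Proof.
case: s => [//|c s]; rewrite /reduced /= => Rs Rt H.
by rewrite cat_path Rs /= H Rt.
Qed.

Lemma reduced_cat_nseq s a b n : reduced s -> a != inv_letter (last b s) ->
  reduced (s ++ nseq n a).
Proof.
case: n => [|n] R H; first by rewrite cats0.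
exact: (reduced_cat (a := b) R (reduced_nseq a n.+1) H).
Qed.

Lemma munn_prefix w s : reduced w -> s \in munn w -> exists t, w = s ++ t.
Proof.
elim: w s => [|a w IH] s R; first by rewrite mem_munn0 => /eqP->; exists [::].
rewrite mem_munn_cons => /orP[/eqP->|/fimsetP[r /(IH _ (reduced_behead R))[t Ew] ->]].
  by exists (a :: w).
exists t; rewrite lmul_cons ?cat_cons -?Ew //.
move: R; rewrite reduced_cons Ew => /andP[+ _]; by case: (r).
Qed.

Lemma mem_munn_nseq a n t : t \in munn (nseq n a) -> exists2 j, j <= n & t = nseq j a.
Proof.
move/(munn_prefix (reduced_nseq a n)) => [r E]; exists (size t).
  by have := congr1 size E; rewrite size_nseq size_cat; lia.
apply/all_pred1P; have : all (pred1 a) (nseq n a) by rewrite all_pred1_nseq.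
by rewrite E all_cat => /andP[].
Qed.

Lemma other_letter (x y : X) a b : x != y -> exists2 c, c != a & c != b.
Proof.
move=> xy.
have H1 : inl x != inl y :> L by apply: contra xy => /eqP[->].
have [Ea|Na] := eqVneq (inl x) a; have [Eb|Nb] := eqVneq (inl x) b.
- by exists (inr x); rewrite -?Ea -?Eb.
- have [E|N] := eqVneq (inl y) b; last by exists (inl y); rewrite -?Ea 1?eq_sym // eq_sym.
  by exists (inr x); rewrite -?Ea -?E.
- have [E|N] := eqVneq (inl y) a; last by exists (inl y); rewrite -?Eb 1?eq_sym // eq_sym.
  by exists (inr x); rewrite -?Eb -?E.
- by exists (inl x).
Qed.

(** A power of d longer than s cannot be cancelled by s, so that translation by it
    brings s into the cone of d. *)
Lemma act_nseq d n s : size s < n -> exists s', act (nseq n d) s = d :: s'.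
Proof.
elim: n s => [//|n IH] s lt.
have -> : act (nseq n.+1 d) s = act (nseq n d) (lmul d s).
  by rewrite -addn1 nseqD act_cat.
case: lmulP => [H|t E]; last by apply: IH; rewrite E /= in lt; lia.
exists (nseq n d ++ s); rewrite /act; elim: (n) => [|m Em] //=.
rewrite Em lmul_cons //; case: (m) => [|k] /=;
  by rewrite (inj_eq (@Some_inj _)) eq_sym inv_letter_neq.
Qed.

(** A loop w conjugated by z shows the tree of w translated by z. *)
Lemma munn_conj z w : (forall s, reduced s -> act w s = s) ->
  munn (z ++ w ++ inv_word z) = munn z `|` (act z @` munn w).
Proof.
move=> aw; apply/fsetP=> s; rewrite in_fsetU catA mem_munn_cat.
have -> : act (z ++ w) @` munn (inv_word z) = munn z.
  rewrite -[RHS]act_imfset_munnV; apply: eq_in_imfset => r /munn_reduced R.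
  by rewrite act_cat aw.
by rewrite mem_munn_cat orbAC orbb.
Qed.

Lemma act_conj z w : (forall s, reduced s -> act w s = s) ->
  act (z ++ w ++ inv_word z) [::] = [::].
Proof. by move=> aw; rewrite !act_cat aw ?act_reduced // actKV. Qed.

Section Quotient.
Variables (M : inverseMonoidType) (i : X -> M).
Local Notation ev := (eval_word i).

(** If the trees agree but the end points g and h differ, continue both words by a
    power a^n, with a chosen such that g a^n and h a^n are reduced.  For large n the
    vertex g a^n is outside the common tree, and with g at least as long as h it
    is not on the path from h to h a^n either. *)
Lemma distinct_trees (x y : X) u v : x != y -> ev u = ev v ->
  ~ (munn u = munn v /\ act u [::] = act v [::]) ->
  exists u' v', ev u' = ev v' /\ ~ {subset munn u' <= munn v'}.
Proof.
move=> xy; have sym (u' v' : invword X) : ev u' = ev v' -> munn u' <> munn v' ->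
    exists u' v', ev u' = ev v' /\ ~ {subset munn u' <= munn v'}.
  move=> E N; have [H|/fsubsetP H] := boolP (munn u' `<=` munn v'); last by exists u', v'.
  exists v', u'; split=> // /fsubsetP H'; apply: N; apply/eqP.
  by rewrite eqEfsubset H H'.
wlog le : u v / size (act v [::]) <= size (act u [::]).
  move=> W E N; have [le|/ltnW le] := leqP (size (act v [::])) (size (act u [::])).
    exact: (W u v).
  by apply: (W v u) => // -[E1 E2]; apply: N.
move=> E N; have [Em|/eqP Nm] := eqVneq (munn u) (munn v); last exact: sym Nm.
set g := act u [::] in le N; set h := act v [::] in le N.
have gh : g <> h by move=> Eg; apply: N.
have [a ag ah] := other_letter (inv_letter (last (inl x) g)) (inv_letter (last (inl x) h)) xy.
have Rg : reduced g by exact: act_reduced.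
have Rh : reduced h by exact: act_reduced.
have Eg n : act u (nseq n a) = g ++ nseq n a.
  by rewrite -act_nil ?reduced_nseq // act_cat_reduced // (reduced_cat_nseq _ Rg ag).
have Eh n : act v (nseq n a) = h ++ nseq n a.
  by rewrite -act_nil ?reduced_nseq // act_cat_reduced // (reduced_cat_nseq _ Rh ah).
pose n := (size v).+1; exists (u ++ nseq n a), (v ++ nseq n a).
split=> [|sub]; first by rewrite !eval_word_cat E.
have : g ++ nseq n a \in munn (v ++ nseq n a).
  have En : act (nseq n a) [::] = nseq n a.
    by rewrite act_cat_reduced ?cats0 // reduced_nseq.
  by apply: sub; rewrite -Eg -{1}En -act_cat; exact: act_munn.
rewrite mem_munn_cat => /orP[/size_munn|/fimsetP[t /mem_munn_nseq[j lej ->]]].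
  by rewrite size_cat size_nseq /n; lia.
rewrite Eh => Es; have := congr1 size Es; rewrite !size_cat !size_nseq => Ez.
have Esz : size g = size h.
  by move: le lej Ez; move: (size g) (size h) (n) => *; lia.
by apply: gh; have := congr1 (take (size g)) Es; rewrite {2}Esz !take_size_cat.
Qed.

(** The value in M of a loop depends on its tree only; here the word [w'] with this
    value is shorter than a geodesic loop around T. *)
Definition shortcut T := exists2 w', size w' < cost T [::] &
  forall w, munn w = T -> act w [::] = [::] -> ev w = ev w'.

(** Let p and q be loops around the tree of v and around the union of both trees.
    They have the same value in M, and so do their conjugates by z = d^k e.  For large
    k the conjugated trees lie in the cone of d, and the letter e is chosen such that
    translation by z keeps the new vertex of q off the path to z.  The tree of the
    conjugate of p is then strictly smaller, which makes its geodesic loop shorter. *)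
Lemma shortcut_exists (x y : X) u v d : x != y -> ev u = ev v -> ~ {subset munn u <= munn v} ->
  exists T, [/\ is_tree T, forall a, [:: a] \in T -> a = d & shortcut T].
Proof.
move=> xy E Nsub; have [t tu tv] : exists2 t, t \in munn u & t \notin munn v.
  by apply/fsubsetPn/negP => /fsubsetP.
have [p [mp ap Ep]] : exists p, [/\ munn p = munn v,
    forall s, reduced s -> act p s = s & ev p = ran (ev v)].
  exists (v ++ inv_word v); split; last by rewrite eval_word_cat eval_word_inv.
    by apply/fsetP=> s; rewrite mem_munnVV.
  exact: act_munnVV.
have [q [mq aq Eq]] : exists q, [/\ munn q = munn v `|` munn u,
    forall s, reduced s -> act q s = s & ev q = ran (ev v)].
  exists ((v ++ inv_word v) ++ (u ++ inv_word u)); split.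
  - by apply/fsetP=> s; rewrite in_fsetU mem_munnVV_cat mem_munnVV.
  - by move=> s R; rewrite act_cat !act_munnVV.
  - by rewrite !eval_word_cat !eval_word_inv E; exact: ran_idem.
have Rt := munn_reduced tu.
have [z [Rz Rzt Hz sz]] : exists z, [/\ reduced z, reduced (z ++ t),
    forall s, size s <= size q -> exists r, act z s = d :: r &
    exists r, z = d :: r].
  have [e ed et] := other_letter (inv_letter d) (inv_letter (head d t)) xy.
  exists (nseq (size q).+2 d ++ [:: e]); split; last by exists (nseq (size q).+1 d ++ [:: e]).
  - apply: (reduced_cat (a := d)); rewrite ?reduced_nseq //.
    by rewrite -(addn1 (size q).+1) nseqD last_cat.
  - case: t Rt et {tu tv} => [_ _|b t Rt et].
      rewrite cats0; apply: (reduced_cat (a := d)); rewrite ?reduced_nseq //.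
      by rewrite -(addn1 (size q).+1) nseqD last_cat.
    apply: (reduced_cat (a := d)) => //.
      apply: (reduced_cat (a := d)); rewrite ?reduced_nseq //.
      by rewrite -(addn1 (size q).+1) nseqD last_cat.
    by rewrite last_cat /=; apply: contra et => /eqP->; rewrite inv_letterK.
  - move=> s le; rewrite act_cat; apply: act_nseq.
    by have := size_act [:: e] s; rewrite /=; lia.
exists (munn (z ++ q ++ inv_word z)); split; first exact: is_tree_munn.
  move=> a; rewrite munn_conj // in_fsetU => /orP[|/fimsetP[s /size_munn le]].
    by case: sz => r -> in Rz * => /(munn_prefix Rz)[r' []].
  by have [r ->] := Hz s le => -[].
have [w' [Mw' Aw' Sw']] := tree_word (is_tree_munn (z ++ p ++ inv_word z)) (act_munn _).
exists w'; last first.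
  move=> w Mw Aw; transitivity (ev (z ++ q ++ inv_word z)).
    by apply: munn_eval; rewrite ?Mw ?Aw ?act_conj.
  transitivity (ev (z ++ p ++ inv_word z)); first by rewrite !eval_word_cat Ep Eq.
  by apply: munn_eval; rewrite ?Mw' ?Aw'.
rewrite Sw' act_conj // /cost !munn_conj // !subn0.
have lt : #|` munn z `|` (act z @` munn p)| < #|` munn z `|` (act z @` munn q)|.
  apply: fproper_ltn_card; apply/andP; split.
    by apply: fsetUS; apply: subset_imfset => s; rewrite /= mp mq in_fsetU => ->.
  apply/fsubsetPn; exists (act z t).
    by rewrite in_fsetU mem_fimset ?orbT // mq in_fsetU tu orbT.
  rewrite in_fsetU negb_or; apply/andP; split.
    apply/negP => /size_munn; rewrite act_cat_reduced // size_cat.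
    by case: (t) tv => [|b t'] /=; [rewrite munn_nil|lia].
  apply/negP => /fimsetP[r]; rewrite mp => rv /(act_inj Rt (munn_reduced rv)) E'.
  by rewrite E' rv in tv.
have : 0 < #|` munn z `|` (act z @` munn p)|.
  by rewrite cardfs_gt0; apply/fset0Pn; exists [::]; rewrite in_fsetU munn_nil.
move: lt; move: #|` _| #|` _| => m n; lia.
Qed.

(** The tree [rest c T] is what hangs off the trunk at the root.  The recursion moves
    the root along the trunk and imposes nothing at its end g. *)
Fixpoint trunk_avoids (B : pred {fset seq L}) T g : bool :=
  if g is c :: g' then ~~ B (rest c T) && trunk_avoids B (branch c T) g' else true.

(** The walk around T splits at each trunk vertex into a loop around the decoration
    and the rest, so that a shortcut of the decoration would make it shorter. *)
Lemma geodesic_trunk_avoids (B : pred {fset seq L}) w :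
  (forall T, B T -> shortcut T) ->
  (forall w', ev w' = ev w -> size w <= size w') ->
  trunk_avoids B (munn w) (act w [::]).
Proof.
move=> HB min.
have {min} : forall w', ev w' = ev w -> cost (munn w) (act w [::]) <= size w'.
  by move=> w' /min; apply: leq_trans; exact: cost_munn.
have := act_munn w; move Ew: (act w [::]) => g.
elim: g w Ew => [//|c g IH] w Ew gT min; have HT := is_tree_munn w.
have cT := is_tree_head HT gT; have HR := is_tree_rest c HT.
have [u [Mu Au Su]] : exists u, [/\ munn u = rest c (munn w), act u [::] = [::]
    & size u = cost (rest c (munn w)) [::]] by apply: tree_word => //; case: HR.
have [|v [Mv Av Sv]] := tree_word (g := g) (is_tree_branch HT cT); first by rewrite mem_branch.
have Euv : ev (u ++ c :: v) = ev w.
  apply: munn_eval.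
    by rewrite munn_graft // Mv ?Mu ?graft_split // branch_avoid.
  rewrite act_cat act_loop // ?act_reduced //= Av Ew lmul_cons //.
  by case: HT => _ _ /(_ _ gT); rewrite reduced_cons => /andP[].
rewrite eval_word_cat eval_cons in Euv.
rewrite (cost_split HT gT) in min; apply/andP; split.
  apply/negP => /HB [w' lt Ew'].
  have := min (w' ++ c :: v); rewrite eval_word_cat eval_cons -(Ew' u) // Euv => /(_ erefl).
  rewrite size_cat /= Sv; lia.
rewrite -Mv; apply: IH => //.
  by rewrite Mv mem_branch.
move=> w' Ew'; have := min (u ++ c :: w').
rewrite eval_word_cat eval_cons Ew' Euv => /(_ erefl).
rewrite size_cat /= Su Mv; lia.
Qed.

End Quotient.
End Shortcuts.

(** * Sums over trees, cut along the trunk *)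

Section SumInjection.
Local Open Scope ring_scope.
Variable R : realType.

(** The inequalities between generating functions below all come from injections
    of finite families. *)
Lemma ler_sum_inj (I J : eqType) (r : seq I) (s : seq J) (phi : I -> J)
    (f : I -> R) (g : J -> R) :
  uniq r -> {in r &, injective phi} -> (forall i, i \in r -> phi i \in s) ->
  (forall i, i \in r -> f i <= g (phi i)) -> (forall j, 0 <= g j) ->
  \sum_(i <- r) f i <= \sum_(j <- s) g j.
Proof.
move=> + + + + g0; elim: r s => [|i r IH] s /=.
  by move=> *; rewrite big_nil; apply: sumr_ge0.
move=> /andP[ir Ur] phiI rs fg.
rewrite big_cons (perm_big _ (perm_to_rem (rs i (mem_head i r)))) big_cons.
apply: lerD; first exact/fg/mem_head.
apply: IH => // [j k jr kr|j jr|j jr]; [|apply: rem_mem|].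
- by apply: phiI; rewrite inE ?jr ?kr orbT.
- by apply: contraNneq ir => /phiI <- //; rewrite inE ?eqxx ?jr ?orbT.
- by apply: rs; rewrite inE jr orbT.
- by apply: fg; rewrite inE jr orbT.
Qed.

Lemma expr_unbounded (x C : R) : 1 < x -> exists m, C < x ^+ m.
Proof.
move=> x1; have y0 : 0 < x - 1 by rewrite subr_gt0.
have bern m : 1 + m%:R * (x - 1) <= x ^+ m.
  elim: m => [|m IH]; first by rewrite mul0r addr0 expr0.
  rewrite exprS; apply: le_trans (ler_wpM2l _ IH); last by lra.
  rewrite -natr1; have := mulr_ge0 (ler0n R m) (sqr_ge0 (x - 1)).
  by rewrite expr2; move: (m%:R : R) => k; nra.
exists (Num.truncn (C / (x - 1))).+1; apply: lt_le_trans (bern _).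
have := real_truncnS_gt (num_real (C / (x - 1))).
rewrite ltr_pdivrMr // => H; apply: lt_le_trans H _; by rewrite lerDr.
Qed.

End SumInjection.

Section TreeLists.
Variable X : finType.
Local Notation L := (X + X)%type.
Implicit Types (a b c : L) (s g : seq L) (A : seq L).
Implicit Types (T D S : {fset seq L}) (B : pred {fset seq L}).

Fixpoint words n : seq (seq L) :=
  if n is n'.+1 then [::] :: [seq a :: s | a <- enum {: L}, s <- words n'] else [:: [::]].

Lemma mem_words n s : size s <= n -> s \in words n.
Proof.
elim: n s => [|n IH] [|a s] //= le; rewrite inE /=.
by apply: allpairs_f; rewrite ?mem_enum ?IH.
Qed.

(** A tree with at most n vertices consists of words of length less than n, so that
    [words n] contains all trees that are wanted. *)
Definition trees n : seq {fset seq L} :=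
  [fset T in fpowerset [fset s in words n]%fset | `[< is_tree T >] && (#|` T| <= n)]%fset.

Lemma mem_trees n T : (T \in trees n) = `[< is_tree T >] && (#|` T| <= n).
Proof.
rewrite !inE fpowersetE; apply: andb_idl => /andP[/asboolP HT le].
apply/fsubsetP => s sT; rewrite inE; apply: mem_words.
exact: ltnW (leq_trans (size_lt_card_tree HT sT) le).
Qed.

Lemma trees_uniq n : uniq (trees n).
Proof. exact: fset_uniq. Qed.

Definition avoids A T := all (fun a => [:: a] \notin T) A.

(** The trees that may hang at a trunk vertex; A lists the directions of its trunk
    neighbours. *)
Definition decorations B A n := [seq T <- trees n | ~~ B T && avoids A T].

(** Trees with a trunk of length l, the letters of A being forbidden at the root. *)
Definition munn_pairs B A l n :=
  [seq p <- [seq (T, g) | T <- trees n, g <- enum_fset T] |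
    [&& avoids A p.1, size p.2 == l & trunk_avoids B p.1 p.2]].

Lemma mem_decorations B A n T : reflect [/\ is_tree T, #|` T| <= n, ~~ B T & avoids A T]
  (T \in decorations B A n).
Proof.
rewrite mem_filter mem_trees; apply: (iffP and3P) => [[/andP[BT AT] /asboolP HT le]|[HT le BT AT]].
  by [].
by split=> //; [rewrite BT|apply/asboolP].
Qed.

Lemma mem_munn_pairs B A l n T g :
  reflect [/\ is_tree T, #|` T| <= n, g \in T & [/\ avoids A T, size g = l & trunk_avoids B T g]]
  ((T, g) \in munn_pairs B A l n).
Proof.
rewrite mem_filter; apply: (iffP andP) => /=.
  move=> [/and3P[AT /eqP gl BT] /allpairsPdep[T' [g' [+ gT [E1 E2]]]]].
  by rewrite -E1 -E2 in gT *; rewrite mem_trees => /andP[/asboolP HT le].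
move=> [HT le gT [AT gl BT]]; split; first by rewrite AT gl eqxx.
apply/allpairsPdep; exists T, g; split=> //; rewrite mem_trees le andbT; exact/asboolP.
Qed.

Lemma decorations_uniq B A n : uniq (decorations B A n).
Proof. by rewrite filter_uniq ?trees_uniq. Qed.

Lemma munn_pairs_uniq B A l n : uniq (munn_pairs B A l n).
Proof.
apply/filter_uniq/allpairs_uniq_dep; first exact: trees_uniq.
  by move=> T _; exact: fset_uniq.
by move=> [T g] [T' g'] _ _ /= [-> ->].
Qed.

(** The data into which a Munn tree with trunk c :: g is cut at its root: the letter
    c, the decoration of the root, and the Munn tree seen from the vertex c. *)
Definition triples B A l n k :=
  [seq (c, x) | c <- [seq c <- enum {: L} | c \notin A],
    x <- [seq (D, p) | D <- decorations B (c :: A) n, p <- munn_pairs B [:: inv_letter c] l k]].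

Lemma mem_triples B A l n k c D p : reflect
  [/\ c \notin A, D \in decorations B (c :: A) n & p \in munn_pairs B [:: inv_letter c] l k]
  ((c, (D, p)) \in triples B A l n k).
Proof.
apply: (iffP idP) => [/allpairsPdep[c' [x [+ /allpairsP[[D' p'] /= [HD Hp ->]] [-> -> ->]]]]|].
  by rewrite mem_filter => /andP[].
move=> [cA HD Hp]; apply/allpairsPdep; exists c, (D, p).
split=> //; first by rewrite mem_filter cA mem_enum.
by apply/allpairsP; exists (D, p).
Qed.

Lemma triples_uniq B A l n k : uniq (triples B A l n k).
Proof.
apply: allpairs_uniq_dep; first by rewrite filter_uniq ?enum_uniq.
  move=> c _; apply: allpairs_uniq; rewrite ?decorations_uniq ?munn_pairs_uniq //.
  by move=> [D p] [D' p'] _ _ /= [-> ->].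
by move=> [c x] [c' x'] _ _ /= [-> ->].
Qed.

End TreeLists.

Section Weights.
Variable X : finType.
Local Notation L := (X + X)%type.
Variables (R : realType) (z : R).
Local Open Scope ring_scope.
Hypotheses (z0 : 0 < z) (z1 : z <= 1).
Implicit Types (a b c : L) (s g : seq L) (A : seq L).
Implicit Types (T D S : {fset seq L}) (B : pred {fset seq L}).

Definition decoration_sum B A n : R := \sum_(T <- decorations B A n) z ^+ cost T [::].
Definition munn_sum B A l n : R := \sum_(p <- munn_pairs B A l n) z ^+ cost p.1 p.2.

Lemma exprz_ge0 k : 0 <= z ^+ k. Proof. by rewrite exprn_ge0 // ltW. Qed.

Lemma decoration_sum_ge0 B A n : 0 <= decoration_sum B A n.
Proof. by apply: sumr_ge0 => T _; exact: exprz_ge0. Qed.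

Lemma munn_sum_ge0 B A l n : 0 <= munn_sum B A l n.
Proof. by apply: sumr_ge0 => T _; exact: exprz_ge0. Qed.

Lemma sum_triples B A l n k :
  \sum_(x <- triples B A l n k) z * z ^+ cost x.2.1 [::] * z ^+ cost x.2.2.1 x.2.2.2 =
  \sum_(c | c \notin A) z * decoration_sum B (c :: A) n * munn_sum B [:: inv_letter c] l k.
Proof.
rewrite big_allpairs_dep big_filter big_enum_cond; apply: eq_bigr => c _.
rewrite big_allpairs_dep /decoration_sum mulr_sumr mulr_suml; apply: eq_bigr => D _.
by rewrite mulr_sumr.
Qed.

Lemma avoids1 c A T : avoids (c :: A) T = ([:: c] \notin T) && avoids A T.
Proof. by []. Qed.

Lemma avoids_graft c A D S : c \notin A -> avoids A D -> avoids A (graft c D S).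
Proof.
move=> cA /allP AD; apply/allP => a aA; rewrite mem_graft negb_or AD //=.
by apply: contraNN cA => /andP[/eqP<-].
Qed.

Lemma trunk_avoids_graft B c D S g : is_tree D -> [:: c] \notin D ->
  trunk_avoids B (graft c D S) (c :: g) = ~~ B D && trunk_avoids B S g.
Proof. by move=> HD Dc; rewrite /= rest_graft ?branch_graft. Qed.

Lemma cost_graft c D S g : is_tree D -> [:: c] \notin D -> is_tree S -> g \in S ->
  [:: inv_letter c] \notin S ->
  cost (graft c D S) (c :: g) = (cost D [::] + cost S g + 1)%N.
Proof.
move=> HD Dc HS gS Sc; rewrite cost_split; first by rewrite rest_graft ?branch_graft.
  exact: is_tree_graft.
by rewrite mem_graft eqxx gS orbT.
Qed.

(** Grafting is injective on triples and adds costs, with one more for the trunk edge. *)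
Lemma munn_sum_split_ge B A l n k :
  \sum_(c | c \notin A) z * decoration_sum B (c :: A) n * munn_sum B [:: inv_letter c] l k <=
  munn_sum B A l.+1 (n + k).
Proof.
rewrite -sum_triples.
apply: (@ler_sum_inj _ _ _ _ _ (fun x => (graft x.1 x.2.1 x.2.2.1, x.1 :: x.2.2.2))).
- exact: triples_uniq.
- move=> [c [D [S g]]] [c' [D' [S' g']]] /mem_triples[_ /mem_decorations[HD _ _ AD] _].
  move=> /mem_triples[_ /mem_decorations[HD' _ _ AD'] _] /= [EG Ec Eg].
  move: AD' AD; rewrite -Ec !avoids1 => /andP[AD' _] /andP[AD _]; rewrite -Ec in EG.
  have ED : D = D' by rewrite -(rest_graft S HD AD) EG rest_graft.
  have ES : S = S' by rewrite -(branch_graft S HD AD) EG branch_graft.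
  by rewrite Ec Eg ED ES.
- move=> [c [D [S g]]] /mem_triples[cA /mem_decorations[HD le BD]].
  rewrite avoids1 => /andP[cD AD] /mem_munn_pairs[HS le' gS [+ gl BS]].
  rewrite /avoids /= andbT => Sc; apply/mem_munn_pairs; split.
  + exact: is_tree_graft.
  + by rewrite card_graft // leq_add.
  + by rewrite mem_graft eqxx gS orbT.
  + by rewrite avoids_graft // trunk_avoids_graft // BD BS /= gl.
- move=> [c [D [S g]]] /mem_triples[cA /mem_decorations[HD le BD]].
  rewrite avoids1 => /andP[cD AD] /mem_munn_pairs[HS le' gS [+ gl BS]].
  rewrite /avoids /= andbT => Sc; rewrite cost_graft // !exprD expr1.
  by rewrite [leRHS]mulrC mulrA.
- by move=> j; exact: exprz_ge0.
Qed.

(** Conversely, cutting at the root loses nothing and only makes trees smaller. *)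
Lemma munn_sum_split_le B A l n :
  munn_sum B A l.+1 n <=
  \sum_(c | c \notin A) z * decoration_sum B (c :: A) n * munn_sum B [:: inv_letter c] l n.
Proof.
rewrite -sum_triples.
pose F (x : L * ({fset seq L} * ({fset seq L} * seq L))) : R :=
  z * z ^+ cost x.2.1 [::] * z ^+ cost x.2.2.1 x.2.2.2.
have -> : \sum_(x <- triples B A l n n) F x =
    \sum_(o <- map Some (triples B A l n n)) oapp F 0 o by rewrite big_map.
apply: (@ler_sum_inj _ _ _ _ _ (fun p : _ * seq L => let T := p.1 in
  if p.2 is c :: g then Some (c, (rest c T, (branch c T, g))) else None)).
- exact: munn_pairs_uniq.
- move=> [T [|c g]] [T' [|c' g']] // /mem_munn_pairs[_ _ _ [_ // _ _]].
  move=> /mem_munn_pairs[_ _ _ [_ // _ _]] [<- Er Eb <-].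
  by congr (_, _); rewrite -(graft_split c T) Er Eb graft_split.
- move=> [T [|c g]] /mem_munn_pairs[HT le gT [AT // [gl] /= /andP[BD BT]]].
  have cT := is_tree_head HT gT.
  have leT := card_split c HT.
  apply: map_f; apply/mem_triples; split.
  + by apply/negP => /(allP AT); rewrite cT.
  + apply/mem_decorations; split=> //; first exact: is_tree_rest.
      by apply: leq_trans le; rewrite leT leq_addr.
    rewrite avoids1 rest_avoid /=; apply/allP => a /(allP AT); exact: rest_avoid2.
  + apply/mem_munn_pairs; split; [exact: is_tree_branch| |by rewrite mem_branch|].
      by apply: leq_trans le; rewrite leT leq_addl.
    by split=> //; rewrite /avoids /= branch_avoid.
- move=> [T [|c g]] /mem_munn_pairs[HT le gT [AT // [gl] /= /andP[BD BT]]].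
  by rewrite /F cost_split //= !exprD expr1 [leLHS]mulrC mulrA.
- case=> [x|] //=; rewrite /F; by rewrite !mulr_ge0 ?exprz_ge0 // ltW.
Qed.

End Weights.

(** * The transfer matrix *)

Section Transfer.
Variable X : finType.
Local Notation L := (X + X)%type.
Variables (R : realType) (z : R).
Local Open Scope ring_scope.
Hypotheses (z0 : 0 < z) (z1 : z <= 1).
Implicit Types (a b c d : L) (s g : seq L) (A : seq L).
Implicit Types (T D S : {fset seq L}) (B : pred {fset seq L}).
Local Notation V := (decoration_sum z).
Local Notation W := (munn_sum z).
Local Notation free := (pred0 : pred {fset seq L}).

(** The state a is the letter that leads back along the trunk.  The step from state
    a to state b takes the letter c = b^-1, from where b leads back. *)
Definition transfer n a b : R :=
  if inv_letter b != a then z * V free [:: inv_letter b; a] n else 0.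

Fixpoint transfer_pow n l a b : R :=
  if l is l'.+1 then \sum_d transfer n a d * transfer_pow n l' d b else (a == b)%:R.

Lemma transfer_ge0 n a b : 0 <= transfer n a b.
Proof. by rewrite /transfer; case: ifP => // _; rewrite mulr_ge0 ?decoration_sum_ge0 // ltW. Qed.

Lemma transfer_pow_ge0 n l a b : 0 <= transfer_pow n l a b.
Proof.
elim: l a => [|l IH] a /=; first exact: ler0n.
by apply: sumr_ge0 => d _; rewrite mulr_ge0 // transfer_ge0.
Qed.

Lemma transfer_pow1 n a b : transfer_pow n 1 a b = transfer n a b.
Proof.
rewrite /= (bigD1 b) //= eqxx mulr1 big1 ?addr0 // => d /negPf->.
by rewrite mulr0.
Qed.

Lemma transfer_pow_mul_le n l m a c b :
  transfer_pow n l a c * transfer_pow n m c b <= transfer_pow n (l + m) a b.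
Proof.
elim: l a => [|l IH] a /=.
  by have [->|_] := eqVneq a c; rewrite ?mul1r // mul0r transfer_pow_ge0.
rewrite mulr_suml; apply: ler_sum => d _.
by rewrite -mulrA ler_wpM2l ?transfer_ge0.
Qed.

Lemma transfer_pow_expr_le n l m a : transfer_pow n l a a ^+ m <= transfer_pow n (m * l) a a.
Proof.
elim: m => [|m IH]; first by rewrite expr0 mul0n /= eqxx.
rewrite exprS mulSn; apply: le_trans (transfer_pow_mul_le _ _ _ _ a _).
by rewrite ler_wpM2l ?transfer_pow_ge0.
Qed.

Lemma inv_letter_bij : bijective (@inv_letter X).
Proof. exact: Bijective (@inv_letterK X) (@inv_letterK X). Qed.

Lemma sum_transfer n a (f : L -> R) :
  \sum_b transfer n a b * f b =
  \sum_(c | c \notin [:: a]) z * V free [:: c; a] n * f (inv_letter c).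
Proof.
rewrite (reindex (@inv_letter X)) /=; last exact/onW_bij/inv_letter_bij.
rewrite [RHS]big_mkcond; apply: eq_bigr => c _.
by rewrite /transfer inv_letterK inE; case: eqP; rewrite /= ?mul0r.
Qed.

Lemma tree1 : is_tree ([fset [::]]%fset : {fset seq L}).
Proof.
split=> [|s t|s]; rewrite !inE //; last by move/eqP->.
by case: s.
Qed.

(** The powers of the transfer matrix sum over the Munn trees whose end point
    carries no decoration. *)
Lemma sum_transfer_pow_le n l a : \sum_b transfer_pow n l a b <= W free [:: a] l (l * n).+1.
Proof.
elim: l a => [|l IH] a /=.
  rewrite (bigD1 a) //= eqxx big1 => [|b /negPf]; last by rewrite eq_sym => ->.
  rewrite addr0 -[1](@big_seq1 R 0 +%R unit tt (fun=> 1)).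
  apply: (@ler_sum_inj _ _ _ _ _ (fun=> ([fset [::]]%fset, [::]))) => //.
  - by move=> [] [].
  - move=> _ _; apply/mem_munn_pairs; split; rewrite ?cardfs1 ?inE //; first exact: tree1.
    by split=> //; rewrite /avoids /= inE.
  - by move=> _ _; rewrite /cost cardfs1 /= expr0.
  - by move=> j; exact: exprz_ge0.
rewrite exchange_big /=; under eq_bigr do rewrite -mulr_sumr.
apply: (@le_trans _ _ (\sum_d transfer n a d * W free [:: d] l (l * n).+1)).
  by apply: ler_sum => d _; rewrite ler_wpM2l ?transfer_ge0.
rewrite sum_transfer mulSn -addnS; exact: munn_sum_split_ge.
Qed.

(** This holds if z is at most the inverse of the growth rate of the free inverse
    monoid, because the cost of a tree is linear in the number of its vertices. *)
Hypothesis subexp : forall (x : R) k, 1 < x ->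
  exists C, forall m a l, W free [:: a] l (m * k).+1 <= C * x ^+ m.

(** A diagonal entry above 1 of some power has exponentially growing powers, and
    these are bounded by sums over balls of linearly growing radius. *)
Lemma transfer_pow_diag_le1 n l a : transfer_pow n l a a <= 1.
Proof.
rewrite leNgt; apply/negP; set x := transfer_pow n l a a => x1.
have [|C HC] := @subexp ((1 + x) / 2) (l * n); first by lra.
have y0 : 0 < (1 + x) / 2 by lra.
have [|m] := @expr_unbounded R (x / ((1 + x) / 2)) C; first by rewrite ltr_pdivlMr //; lra.
apply/negP; rewrite -leNgt expr_div_n ler_pdivrMr ?exprn_gt0 //.
apply: le_trans (HC m a (m * l)%N); apply: le_trans (transfer_pow_expr_le n l m a) _.
rewrite mulnA; apply: le_trans (sum_transfer_pow_le n (m * l) a).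
by rewrite (bigD1 a) //= lerDl; apply: sumr_ge0 => b _; exact: transfer_pow_ge0.
Qed.

Lemma decoration_sum_ge1 n A : (0 < n)%N -> 1 <= V free A n.
Proof.
move=> n0; rewrite -[1](@big_seq1 R 0 +%R unit tt (fun=> 1)).
apply: (@ler_sum_inj _ _ _ _ _ (fun=> [fset [::]]%fset)) => //.
- by move=> [] [].
- move=> _ _; apply/mem_decorations; split; rewrite ?cardfs1 //; first exact: tree1.
  by apply/allP => a _; rewrite inE.
- by move=> _ _; rewrite /cost cardfs1 /= expr0.
- by move=> j; exact: exprz_ge0.
Qed.

Lemma transfer_ge n a b : (0 < n)%N -> inv_letter b != a -> z <= transfer n a b.
Proof. by move=> n0 H; rewrite /transfer H ler_peMr ?decoration_sum_ge1 // ltW. Qed.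

Variables (x y : X).
Hypothesis xy : x != y.

(** Two more steps with trivial decorations lead from b back to a. *)
Lemma transfer_pow_le n l a b : (0 < n)%N -> transfer_pow n l a b <= z ^- 2.
Proof.
move=> n0; have [d db da] := other_letter (inv_letter b) (inv_letter a) xy.
have H2 : z ^+ 2 <= transfer_pow n 2 b a.
  apply: le_trans (transfer_pow_mul_le n 1 1 b d a); rewrite !transfer_pow1 expr2.
  apply: ler_pM; rewrite ?(ltW z0) //; apply: transfer_ge => //.
    by apply: contra db => /eqP<-; rewrite inv_letterK.
  by rewrite eq_sym.
rewrite -[leRHS]mul1r ler_pdivlMr ?exprn_gt0 //.
apply: le_trans (transfer_pow_diag_le1 n (l + 2) a).
apply: le_trans (transfer_pow_mul_le n l 2 a b a); by rewrite ler_wpM2l ?transfer_pow_ge0.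
Qed.

Lemma decoration_sum2_le n a c : (0 < n)%N -> c != a -> V free [:: c; a] n <= z ^- 3.
Proof.
move=> n0 ca; have := transfer_pow_le 1 a (inv_letter c) n0.
rewrite transfer_pow1 /transfer inv_letterK ca => H.
rewrite -[leRHS]mul1r ler_pdivlMr ?exprn_gt0 // exprS mulrA (mulrC _ z).
by rewrite -ler_pdivlMr ?exprn_gt0 // mul1r.
Qed.

(** A tree is glued from its part in the cone of c, which avoids all other letters,
    and the part outside. *)
Lemma decoration_sum_cut n A A' c : c \notin A' ->
  V free A n <= V free (c :: A) n * V free A' n.
Proof.
move=> cA'; pose cut T := graft c [fset [::]]%fset (branch c T).
have t1 : [:: c] \notin ([fset [::]]%fset : {fset seq L}) by rewrite inE.
have memcut T s : is_tree T -> (s \in cut T) = (s \in T) && ((s == [::]) || (ohead s == Some c)).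
  move=> [T0 _ _]; rewrite mem_graft inE; case: s => [|b s] /=; first by rewrite T0.
  by rewrite mem_branch (inj_eq (@Some_inj _)); case: eqP => [->|]; rewrite ?andbF ?andbT.
have -> : V free (c :: A) n * V free A' n =
    \sum_(p <- [seq (T, T') | T <- decorations free (c :: A) n, T' <- decorations free A' n])
      z ^+ cost p.1 [::] * z ^+ cost p.2 [::].
  by rewrite big_allpairs /decoration_sum mulr_suml; apply: eq_bigr => T _; rewrite mulr_sumr.
apply: (@ler_sum_inj _ _ _ _ _ (fun T => (rest c T, cut T))).
- exact: decorations_uniq.
- move=> T T' /mem_decorations[HT _ _ _] /mem_decorations[HT' _ _ _] [Er Ec].
  rewrite -(graft_split c T) -(graft_split c T') Er.
  by rewrite -(branch_graft (branch c T) tree1 t1) -/(cut T) Ec branch_graft //; exact: tree1.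
- move=> T /mem_decorations[HT le _ AT]; apply: allpairs_f; apply/mem_decorations; split=> //.
  + exact: is_tree_rest.
  + by apply: leq_trans le; rewrite (card_split c HT) leq_addr.
  + rewrite avoids1 rest_avoid /=; apply/allP => a /(allP AT); exact: rest_avoid2.
  + have [T0 Tp Tr] := HT; split=> [|s t|s]; rewrite ?memcut ?T0 //.
      by move=> /andP[/Tp->] /=; case: s.
    by case/andP=> /Tr.
  + apply: leq_trans le; apply: fsubset_leq_card; apply/fsubsetP => s.
    by rewrite memcut // => /andP[].
  + apply/allP => a aA'; rewrite memcut // negb_and orbC /=.
    by rewrite (inj_eq (@Some_inj _)); apply/orP; left; apply: contraNneq cA' => <-.
- move=> T /mem_decorations[HT _ _ _] /=; rewrite -exprD /cost card_graft ?cardfs1 //;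
    last exact: tree1.
  rewrite (card_split c HT) !subn0.
  have -> : (2 * (#|` rest c T| + #|` branch c T|).-1 =
    2 * #|` rest c T|.-1 + 2 * (1 + #|` branch c T|).-1)%N; last by [].
  by have := card_tree_gt0 (is_tree_rest c HT); move: #|` _| #|` _| => p q; lia.
- by move=> p; rewrite mulr_ge0 ?exprz_ge0.
Qed.

Lemma decoration_sum_sub B B' A A' n : (forall T, ~~ B T -> ~~ B' T) -> {subset A' <= A} ->
  V B A n <= V B' A' n.
Proof.
move=> HB HA; apply: (@ler_sum_inj _ _ _ _ _ id); rewrite ?decorations_uniq //.
- move=> T /mem_decorations[HT le BT AT]; apply/mem_decorations; split=> //; first exact: HB.
  by apply/allP => a /HA /(allP AT).
- by move=> T; exact: exprz_ge0.
Qed.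

(** Only the sums with two forbidden letters are entries of the transfer matrix; two
    cuts reduce the unrestricted sum to three of them. *)
Lemma decoration_sum_le n : (0 < n)%N -> V free [::] n <= (z ^- 3) ^+ 3.
Proof.
move=> n0; have N3 : inl x != inl y :> L by apply: contra xy => /eqP[->].
apply: le_trans (decoration_sum_cut n [::] (c := inl x) (A' := [:: inl y; inr y]) _) _.
  by rewrite !inE negb_or N3.
have H : V free [:: inl x] n <= z ^- 3 * z ^- 3.
  apply: le_trans (decoration_sum_cut n _ (c := inr x) (A' := [:: inl y; inl x]) _) _.
    by rewrite !inE.
  by apply: ler_pM; rewrite ?decoration_sum_ge0 // decoration_sum2_le // eq_sym.
rewrite exprS mulrC expr2; apply: ler_pM; rewrite ?decoration_sum_ge0 //.
exact: decoration_sum2_le.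
Qed.

Variable B : pred {fset seq L}.
Variable bad : L -> {fset seq L}.
Hypothesis badP : forall d, [/\ B (bad d), is_tree (bad d) & forall a, [:: a] \in bad d -> a = d].
(* From this size on all bad trees take part in the sums. *)
Let n0 := (\max_d #|` bad d|).+1.
Let eps := z ^+ (2 * n0) * z ^+ 3.
Let theta := 1 - eps.

Lemma eps_gt0 : 0 < eps. Proof. by rewrite mulr_gt0 ?exprn_gt0. Qed.

Lemma theta_ge0 : 0 <= theta.
Proof. by rewrite subr_ge0 /eps -exprD exprn_ile1 // ltW. Qed.

(** For d different from c and a, the bad tree of d is one of the decorations counted
    on the right and contributes a fixed proportion, the sum being at most z^-3. *)
Lemma decoration_sum_bad_le n a c : (n0 <= n)%N -> c != a ->
  V B [:: c; a] n <= theta * V free [:: c; a] n.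
Proof.
move=> le ca; have n_gt0 : (0 < n)%N by apply: leq_trans le.
have [d dc da] := other_letter c a xy; have [Bd Td ad] := badP d.
have cardd : (#|` bad d| < n0)%N by rewrite ltnS (leq_bigmax d).
have H : V B [:: c; a] n + z ^+ cost (bad d) [::] <= V free [:: c; a] n.
  rewrite addrC -(big_cons 0 +%R (bad d) _ (fun=> true) (fun T => z ^+ cost T [::])).
  apply: (@ler_sum_inj _ _ _ _ _ id) => //.
  - rewrite /= decorations_uniq andbT; apply/negP => /mem_decorations[_ _]; by rewrite Bd.
  - move=> T; rewrite inE => /orP[/eqP->|/mem_decorations[HT leT _ AT]];
      apply/mem_decorations; split=> //.
      exact: leq_trans (ltnW cardd) le.
    by rewrite /avoids /= andbT; apply/andP; split; [apply: contra dc|apply: contra da] => /ad->.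
  - by move=> T; exact: exprz_ge0.
have Hd : z ^+ (2 * n0) <= z ^+ cost (bad d) [::].
  rewrite ler_wiXn2l ?(ltW z0) //; rewrite /cost.
  by move: cardd; move: #|` _| => k; lia.
have HV := decoration_sum2_le n_gt0 ca.
have : eps * V free [:: c; a] n <= z ^+ (2 * n0).
  rewrite /eps -mulrA ler_piMr ?exprz_ge0 //.
  by rewrite mulrC -ler_pdivlMr ?exprn_gt0 // mul1r.
rewrite /theta mulrBl mul1r; lra.
Qed.

Let K := (z ^- 3) ^+ 3.

Lemma munn_sum0_le A n : (0 < n)%N -> W B A 0 n <= K.
Proof.
move=> n_gt0; apply: le_trans (decoration_sum_le n_gt0).
have P0 p : p \in munn_pairs B A 0 n -> p.2 = [::].
  by case: p => T g /mem_munn_pairs[_ _ _ [_ /size0nil]].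
apply: (@ler_sum_inj _ _ _ _ _ (fun p : _ * seq L => p.1)).
- exact: munn_pairs_uniq.
- by move=> [T g] [T' g'] /P0 /= -> /P0 /= -> ->.
- by move=> [T g] /mem_munn_pairs[HT le _ _]; apply/mem_decorations.
- by move=> [T g] /P0 /= ->.
- by move=> T; exact: exprz_ge0.
Qed.

(** Each edge of the trunk gains a factor theta. *)
Lemma munn_sum_bad_le n l a : (n0 <= n)%N ->
  W B [:: a] l n <= theta ^+ l * K * \sum_b transfer_pow n l a b.
Proof.
move=> le; have n_gt0 : (0 < n)%N by apply: leq_trans le.
elim: l a => [|l IH] a.
  rewrite expr0 mul1r /= (bigD1 a) //= eqxx big1 ?addr0 ?mulr1; first exact: munn_sum0_le.
  by move=> b /negPf; rewrite eq_sym => ->.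
apply: le_trans (munn_sum_split_le _ _ _ _ _) _ => //=.
rewrite exchange_big /=; under [X in _ * X]eq_bigr do rewrite -mulr_sumr.
rewrite sum_transfer mulr_sumr; apply: ler_sum => c; rewrite inE => ca.
rewrite exprS.
have -> : theta * theta ^+ l * K * (z * V free [:: c; a] n *
    \sum_b transfer_pow n l (inv_letter c) b) =
  (z * (theta * V free [:: c; a] n)) * (theta ^+ l * K * \sum_b transfer_pow n l (inv_letter c) b).
  by ring.
apply: ler_pM; rewrite ?mulr_ge0 ?decoration_sum_ge0 ?munn_sum_ge0 ?(ltW z0) //.
by rewrite ler_pM2l // decoration_sum_bad_le.
Qed.

Lemma munn_sum_bad_bounded : exists C, forall n, (n0 <= n)%N ->
  \sum_(l < n) W B [::] l n <= C.
Proof.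
pose Q := #|{: L}|%:R * (z * K * (K * (#|{: L}|%:R * z ^- 2))).
have K0 : 0 <= K by rewrite !exprn_ge0 // invr_ge0 exprn_ge0 // ltW.
have Q0 : 0 <= Q by rewrite /Q !mulr_ge0 ?invr_ge0 ?exprz_ge0 ?(ltW z0).
exists (K + Q / eps) => n le; have n_gt0 : (0 < n)%N by apply: leq_trans le.
have HS l : W B [::] l.+1 n <= theta ^+ l * Q.
  apply: le_trans (munn_sum_split_le _ _ _ _ _) _ => //=.
  have -> : theta ^+ l * Q = \sum_(c : L) (z * K * (theta ^+ l * K * (#|{: L}|%:R * z ^- 2))).
    by rewrite sumr_const -mulr_natl /Q; ring.
  apply: ler_sum => c _; apply: ler_pM.
  - by rewrite mulr_ge0 ?decoration_sum_ge0 // ltW.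
  - exact: munn_sum_ge0.
  - rewrite ler_pM2l //; apply: le_trans (decoration_sum_le n_gt0); exact: decoration_sum_sub.
  apply: le_trans (munn_sum_bad_le l _ le) _.
  apply: ler_wpM2l; first by rewrite mulr_ge0 // exprn_ge0 // theta_ge0.
  have -> : #|{: L}|%:R * z ^- 2 = \sum_(b : L) z ^- 2 by rewrite sumr_const mulr_natl.
  by apply: ler_sum => b _; exact: transfer_pow_le.
case: n n_gt0 le HS => // n _ le HS; rewrite big_ord_recl; apply: lerD; first exact: munn_sum0_le.
apply: (@le_trans _ _ (\sum_(l < n) theta ^+ l * Q)); first by apply: ler_sum => l _; exact: HS.
rewrite -mulr_suml mulrC ler_wpM2l // -[leRHS]mul1r ler_pdivlMr ?eps_gt0 //.
have -> : eps = 1 - theta by rewrite /theta; ring.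
by rewrite -[leLHS]opprK -mulrN opprB mulrC -subrX1 opprB gerBl exprn_ge0 // theta_ge0.
Qed.

End Transfer.

(** * Limits of roots *)

Section Limsup.
Local Open Scope classical_set_scope.
Local Open Scope ring_scope.
Variable R : realType.
Implicit Types (u : nat -> \bar R) (a : nat -> nat) (r s t z : R).

Lemma limn_esup_inf u : limn_esup u = ereal_inf (range (esups u)).
Proof. by rewrite limn_esup_lim; apply/cvg_lim => //; exact: cvg_esups_inf. Qed.

Lemma limn_esup_le_near u (l : \bar R) n0 :
  (forall n, (n0 <= n)%N -> (u n <= l)%E) -> (limn_esup u <= l)%E.
Proof.
move=> H; rewrite limn_esup_inf.
apply: (@le_trans _ _ (esups u n0)); first by apply: ereal_inf_lbound; exists n0.
by apply: ge_ereal_sup => _ [n /= le <-]; exact: H.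
Qed.

Lemma limn_esup_lt_near u (l : \bar R) : (limn_esup u < l)%E ->
  exists n0, forall n, (n0 <= n)%N -> (u n <= l)%E.
Proof.
rewrite limn_esup_inf => /ereal_inf_lt[_ [n0 _ <-] lt]; exists n0 => n le.
apply: le_trans (ltW lt); apply: ereal_sup_ubound; by exists n.
Qed.

Lemma limn_esup_mono u v : (forall n, (u n <= v n)%E) -> (limn_esup u <= limn_esup v)%E.
Proof.
move=> uv; rewrite !limn_esup_inf; apply: le_ereal_inf_tmp => _ [n0 _ <-].
apply: (@le_trans _ _ (esups u n0)); first by apply: ereal_inf_lbound; exists n0.
apply: ge_ereal_sup => _ [n /= le <-]; apply: le_trans (uv n) _.
by apply: ereal_sup_ubound; exists n.
Qed.

Definition root_rate a : \bar R := limn_esup (fun n => ((a n)%:R `^ (n%:R^-1))%:E).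

Lemma root_le x r n : 0 <= x -> 0 <= r -> (0 < n)%N -> (x `^ (n%:R^-1) <= r) = (x <= r ^+ n).
Proof.
move=> x0 r0 n0; have nN : (n%:R : R) != 0 by rewrite pnatr_eq0 -lt0n.
have Ex : (x `^ (n%:R^-1)) ^+ n = x.
  by rewrite -powR_mulrn ?powR_ge0 // -powRrM mulVf // powRr1.
by rewrite -{2}Ex ler_pXn2r // nnegrE ?powR_ge0.
Qed.

Lemma root_rate_le a r n0 : 0 <= r ->
  (forall n, (n0 <= n)%N -> (a n)%:R <= r ^+ n) -> (root_rate a <= r%:E)%E.
Proof.
move=> r0 H; apply: (@limn_esup_le_near _ _ (maxn 1 n0)) => n.
rewrite geq_max => /andP[n_gt0 /H le]; by rewrite lee_fin root_le.
Qed.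

Lemma root_rate_lt a r : 0 <= r -> (root_rate a < r%:E)%E ->
  exists n0, forall n, (n0 <= n)%N -> (a n)%:R <= r ^+ n.
Proof.
move=> r0 /limn_esup_lt_near[n0 H]; exists (maxn 1 n0) => n.
by rewrite geq_max => /andP[n_gt0 /H]; rewrite lee_fin root_le.
Qed.

Lemma root_rate_le_geometric a C s t : 0 < s -> s < t ->
  (forall n, (a n)%:R <= C * s ^+ n) -> (root_rate a <= t%:E)%E.
Proof.
move=> s0 st H; have st1 : 1 < t / s by rewrite ltr_pdivlMr // mul1r.
have [m Cm] := expr_unbounded C st1.
apply: (@root_rate_le _ _ m); first by apply: ltW; exact: lt_trans st.
move=> n le; apply: le_trans (H n) _.
rewrite -ler_pdivlMr ?exprn_gt0 // -expr_div_n; apply: le_trans (ltW Cm) _.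
by rewrite ler_eXn2l.
Qed.

(** Fekete's argument: one value below r^m bounds the sequence by a geometric one
    with a ratio smaller than r. *)
Lemma root_rate_submul a m : (forall m n, a (m + n) <= a m * a n)%N ->
  (0 < m)%N -> forall r, 0 < r -> (a m)%:R < r ^+ m -> (root_rate a < r%:E)%E.
Proof.
move=> sub m0 r r0 lt.
pose s0 : R := (a m)%:R `^ (m%:R^-1).
have s00 : 0 <= s0 by exact: powR_ge0.
have s0r : s0 < r.
  rewrite ltNge; apply/negP => le; move: lt; rewrite ltNge => /negP; apply.
  have <- : s0 ^+ m = (a m)%:R.
    have nN : (m%:R : R) != 0 by rewrite pnatr_eq0 -lt0n.
    by rewrite -powR_mulrn // -powRrM mulVf // powRr1.
  by rewrite ler_pXn2r // nnegrE ltW.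
pose s := (s0 + r) / 2.
have [ss sr ss0] : [/\ 0 < s, s < r & s0 <= s] by rewrite /s; split; lra.
have am : (a m)%:R <= s ^+ m by rewrite -root_le // ltW.
pose C : R := \sum_(j < m) (a j)%:R / s ^+ j.
have H n : (a n)%:R <= C * s ^+ n.
  elim/ltn_ind: n => n IH; have [nm|mn] := ltnP n m.
    rewrite -ler_pdivrMr ?exprn_gt0 // /C (bigD1 (Ordinal nm)) //= lerDl.
    by apply: sumr_ge0 => j _; rewrite divr_ge0 ?exprn_ge0 // ltW.
  rewrite -{1}(subnKC mn).
  apply: (@le_trans _ _ ((a m)%:R * (a (n - m)%N)%:R)); first by rewrite -natrM ler_nat.
  rewrite -[n in leRHS](subnKC mn) exprD mulrCA; apply: ler_pM => //.
  by apply: IH; lia.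
apply: (@le_lt_trans _ _ (((s + r) / 2)%:E)); last by rewrite lte_fin; lra.
by apply: (root_rate_le_geometric ss) H; lra.
Qed.

Lemma root_gt1 x k : 1 < x -> exists2 y : R, 1 < y & y ^+ k <= x.
Proof.
move=> x1; have [x0 x0'] : 0 < x /\ 0 <= x by split; lra.
exists (x `^ (k.+1%:R^-1)); last first.
  have nN : (k.+1%:R : R) != 0 by rewrite pnatr_eq0.
  have E : (x `^ (k.+1%:R^-1)) ^+ k.+1 = x.
    by rewrite -powR_mulrn ?powR_ge0 // -powRrM mulVf // powRr1.
  rewrite -[leRHS]E ler_weXn2l //.
  by rewrite -[leLHS](powRr0 x) ler_powR ?ltW // invr_gt0.
rewrite ltNge root_le // expr1n; by rewrite -ltNge.
Qed.

(** The terms are eventually at most y^n for each y > 1. *)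
Lemma partial_sums_subexp a r : 0 < r -> (root_rate a <= r%:E)%E -> forall y, 1 < y ->
  exists2 C, 0 <= C & forall N, \sum_(n < N) (a n)%:R / r ^+ n <= C * y ^+ N.
Proof.
move=> r0 ar y y1; have [y0 y0'] : 0 < y /\ 0 <= y by split; lra.
have [||n0 H] := @root_rate_lt a (r * y).
- by rewrite mulr_ge0 // ltW.
- by apply: le_lt_trans ar _; rewrite lte_fin ltr_pMr.
have t0 n : 0 <= (a n)%:R / r ^+ n by rewrite divr_ge0 // exprn_ge0 // ltW.
pose C0 := 1 + \sum_(n < n0) (a n)%:R / r ^+ n.
have C00 : 0 <= \sum_(n < n0) (a n)%:R / r ^+ n by exact: sumr_ge0.
have Hn n : (a n)%:R / r ^+ n <= C0 * y ^+ n.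
  have [lt|le] := ltnP n n0.
    apply: (@le_trans _ _ C0); last first.
      by rewrite ler_peMr ?exprn_ege1 ?ltW // /C0; lra.
    rewrite /C0 (bigD1 (Ordinal lt)) //= addrCA lerDl addr_ge0 //.
    by apply: sumr_ge0.
  apply: (@le_trans _ _ (y ^+ n)).
    by rewrite ler_pdivrMr ?exprn_gt0 // mulrC -exprMn H.
  by rewrite ler_peMl ?exprn_ge0 // /C0; lra.
exists (C0 / (y - 1)); first by rewrite divr_ge0 /C0; lra.
move=> N; apply: (@le_trans _ _ (\sum_(n < N) C0 * y ^+ n)); first by apply: ler_sum => n _.
rewrite -mulr_sumr -mulrA; apply: ler_wpM2l; first by rewrite /C0; lra.
rewrite mulrC ler_pdivlMr; last by lra.
by rewrite mulrC -subrX1; lra.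
Qed.

End Limsup.

(** * Spheres and balls *)

Section Growth.
Local Open Scope classical_set_scope.
Local Open Scope nat_scope.
Variable X : finType.
Implicit Types (M : inverseMonoidType).

Lemma growth_le_image M (i : X -> M) (T : choiceType) (A : set T) (f : T -> M) n :
  finite_set A -> sphere i n `<=` f @` A -> growth i n <= #|` fset_set A|.
Proof.
move=> finA sub; rewrite /growth; apply: (@leq_trans #|` fset_set (f @` A)|).
  apply: fsubset_leq_card; rewrite -fset_set_sub //; first exact: finite_sphere.
  exact: finite_image.
by rewrite fset_set_image // leq_imfset_card.
Qed.

Lemma word_lengthP M (i : X -> M) w :
  (forall w', eval_word i w' = eval_word i w -> size w <= size w') ->
  word_length i (eval_word i w) (size w).
Proof. by move=> min; split; [exists w|]. Qed.

(** A geodesic word of M is geodesic in the free inverse monoid, because a shorter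
    word for the same element there has the same value in M. *)
Lemma growth_lift M (i : X -> M) n : growth i n <= growth (fim_gen : X -> FIM X) n.
Proof.
apply: (@growth_le_image _ _ _ _ (fim_lift i)); first exact: finite_sphere.
move=> _ [[w [<- <-]] min]; exists (eval_word fim_gen w); last first.
  by rewrite eval_fim_gen fim_lift_pi.
apply: word_lengthP => w'; rewrite !eval_fim_gen => /(congr1 (fim_lift i)).
by rewrite !fim_lift_pi; exact: min.
Qed.

Lemma growth_lift_eq M (i : X -> M) n : bijective (fim_lift i) ->
  growth i n = growth (fim_gen : X -> FIM X) n.
Proof.
case=> h hK Kh; apply/eqP; rewrite eqn_leq growth_lift /=.
apply: (@growth_le_image _ _ _ _ h); first exact: finite_sphere.
move=> _ [[w [<- <-]] min]; exists (eval_word i w); last first.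
  by rewrite -fim_lift_pi -eval_fim_gen hK.
apply: word_lengthP => w'; rewrite -!fim_lift_pi => /(can_inj hK) E.
by apply: min; rewrite !eval_fim_gen.
Qed.

(** Both factors of a geodesic word are geodesic. *)
Lemma growth_submul M (i : X -> M) m n : growth i (m + n) <= growth i m * growth i n.
Proof.
have fin : finite_set (sphere i m `*` sphere i n) by apply: finite_setX; exact: finite_sphere.
apply: leq_trans (@growth_le_image _ i _ _ (fun p => p.1 * p.2)%g (m + n) fin _) _.
  move=> _ [[w [<- sw]] min].
  have sz1 : size (take m w) = m by rewrite size_take sw; case: ltnP => //; lia.
  have sz2 : size (drop m w) = n by rewrite size_drop sw; lia.
  exists (eval_word i (take m w), eval_word i (drop m w)); last first.
    by rewrite /= -eval_word_cat cat_take_drop.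
  split=> /=.
    have := @word_lengthP _ i (take m w); rewrite sz1; apply=> w' E; have := min (w' ++ drop m w).
    by rewrite eval_word_cat E -eval_word_cat cat_take_drop size_cat => /(_ erefl); lia.
  have := @word_lengthP _ i (drop m w); rewrite sz2; apply=> w' E; have := min (take m w ++ w').
  by rewrite eval_word_cat E -eval_word_cat cat_take_drop size_cat => /(_ erefl); lia.
rewrite fset_setX; [|exact: finite_sphere|exact: finite_sphere].
rewrite /growth -(size_allpairs (fun x y => (x, y))); apply: uniq_leq_size.
  exact: fset_uniq.
by move=> [x y]; rewrite in_fsetM => /andP[xA yB]; exact: allpairs_f.
Qed.

Lemma growth_le_expn M (i : X -> M) n : growth i n <= growth i 1 ^ n.
Proof.
elim: n => [|n IH]; last first.
  by rewrite expnS; apply: leq_trans (growth_submul i 1 n) _; rewrite leq_mul2l IH orbT.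
apply: leq_trans (@growth_le_image _ i _ [set tt] (fun=> 1%g) 0 _ _) _ => //.
  by move=> _ [[w [<- /size0nil->]] _]; exists tt => //; rewrite /eval_word big_nil.
by rewrite fset_set1 cardfs1.
Qed.

Lemma growth_fim_gt0 (x : X) n : 0 < growth (fim_gen : X -> FIM X) n.
Proof.
rewrite cardfs_gt0; apply/fset0Pn; pose w : invword X := nseq n (inl x).
exists (eval_word fim_gen w); rewrite in_fset_set; last exact: finite_sphere.
rewrite inE /sphere /=.
have -> : n = size w by rewrite size_nseq.
apply: word_lengthP => w'; rewrite !eval_fim_gen => /munn_vagner[_ Ea].
have := size_act w' [::]; rewrite Ea act_cat_reduced ?cats0 ?reduced_nseq //=.
by rewrite addn0.
Qed.

Section Balls.
Local Open Scope ring_scope.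
Variables (R : realType) (z : R).
Hypotheses (z0 : 0 < z) (z1 : z <= 1).

Lemma ball_sum M (i : X -> M) n :
  \sum_(k < n) (growth i k)%:R * z ^+ k =
  \sum_(p <- [seq (k, g) | k <- iota 0 n, g <- enum_fset (fset_set (sphere i k))]) z ^+ p.1.
Proof.
rewrite big_allpairs_dep /= -(big_mkord xpredT (fun k => (growth i k)%:R * z ^+ k)).
rewrite /index_iota subn0; apply: eq_bigr => k _.
by rewrite big_const_seq count_predT iter_addr_0 mulr_natl.
Qed.

Lemma mem_sphere M (i : X -> M) n g : (g \in fset_set (sphere i n)) = `[< word_length i g n >].
Proof.
rewrite in_fset_set; last exact: finite_sphere.
by apply/idP/asboolP; rewrite inE.
Qed.

(** By Munn's theorem distinct pairs (T, g) are distinct elements, of length at most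
    their cost, and z <= 1. *)
Lemma munn_sum_le_ball A l n :
  munn_sum z (pred0 : pred {fset seq (X + X)}) A l n.+1 <=
  \sum_(k < 2 * n.+1) (growth (fim_gen : X -> FIM X) k)%:R * z ^+ k.
Proof.
rewrite ball_sum.
have /choice[f Hf] : forall p, exists q : nat * FIM X, p \in munn_pairs pred0 A l n.+1 ->
    [/\ word_length fim_gen q.2 q.1, (q.1 <= cost p.1 p.2)%N &
    exists w, [/\ munn w = p.1, act w [::] = p.2 & q.2 = (\pi_(FIM X) w)%qT]].
  move=> [T g]; case: (boolP ((T, g) \in _)) => [/mem_munn_pairs[HT le gT _]|_]; last first.
    by exists (0%N, 1%g).
  have [w [Mw Aw Sw]] := tree_word HT gT.
  have [k Hk] := word_length_exists (\pi_(FIM X) w)%qT (@fim_generates X).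
  exists (k, (\pi_(FIM X) w)%qT) => _; split=> //; last by exists w.
  by rewrite -Sw; case: Hk => _; apply; rewrite eval_fim_gen.
apply: (@ler_sum_inj _ _ _ _ _ f).
- exact: munn_pairs_uniq.
- move=> [T g] [T' g'] /Hf[_ _ [w [/= <- <- Ew]]] /Hf[_ _ [w' [/= <- <- Ew']]] E.
  by move: Ew; rewrite E Ew' => /munn_vagner[-> ->].
- move=> [T g] Tg; have [H1 H2 _] := Hf _ Tg; move/mem_munn_pairs: Tg => [HT le _ _].
  apply/allpairsPdep; exists (f (T, g)).1, (f (T, g)).2; rewrite -surjective_pairing.
  split=> //; last by rewrite mem_sphere; apply/asboolP.
  rewrite mem_iota /= add0n; move: H2 le (card_tree_gt0 HT); rewrite /cost /=.
  by move: #|` _| (f _).1 => j k; lia.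
- by move=> p /Hf[_ H _]; rewrite ler_wiXn2l // ltW.
- by move=> p; exact: exprz_ge0.
Qed.

(** A geodesic word of M is determined up to its value by its Munn tree, which has no
    shortcut on the trunk. *)
Lemma ball_le_munn_sum M (i : X -> M) (B : pred {fset seq (X + X)}) n :
  (forall T, B T -> shortcut i T) ->
  \sum_(k < n) (growth i k)%:R * z ^+ k <= \sum_(l < n) munn_sum z B [::] l n.
Proof.
move=> HB; rewrite ball_sum.
rewrite -(big_mkord xpredT (fun l => munn_sum z B [::] l n)) /index_iota subn0.
have -> : \sum_(l <- iota 0 n) munn_sum z B [::] l n =
    \sum_(q <- [seq (l, p) | l <- iota 0 n, p <- munn_pairs B [::] l n]) z ^+ cost q.2.1 q.2.2.
  by rewrite big_allpairs_dep.
have /choice[f Hf] : forall p, exists w, word_length i p.2 p.1 ->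
    eval_word i w = p.2 /\ size w = p.1.
  move=> [k g]; have [[[w H] _]|] := pselect (word_length i g k); first by exists w.
  by move=> N; exists [::].
have Hp k g : (k, g) \in [seq (k, g) | k <- iota 0 n, g <- enum_fset (fset_set (sphere i k))] ->
    (k < n)%N /\ word_length i g k.
  move=> /allpairsPdep[k' [g' [+ + [-> ->]]]].
  by rewrite mem_iota add0n mem_sphere => /= lt /asboolP.
apply: (@ler_sum_inj _ _ _ _ _ (fun p => let w := f p in
  (size (act w [::]), (munn w, act w [::])))).
- apply: allpairs_uniq_dep; first exact: iota_uniq.
    by move=> k _; exact: fset_uniq.
  by move=> [k g] [k' g'] _ _ /= [-> ->].
- move=> [k g] [k' g'] /Hp[_ Hg] /Hp[_ Hg'] /= [_ Em Ea].
  have [Eg _] := Hf (k, g) Hg; have [Eg' _] := Hf (k', g') Hg'.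
  have E : g = g' by rewrite -[g]Eg -[g']Eg'; exact: munn_eval.
  by rewrite E in Hg *; rewrite (word_length_inj Hg Hg').
- move=> [k g] /Hp[lt Hg] /=; have [/= Eg Sg] := Hf (k, g) Hg.
  set w := f (k, g) in Eg Sg *.
  apply/allpairsPdep; exists (size (act w [::])), (munn w, act w [::]); split=> //.
    by rewrite mem_iota add0n /=; apply: leq_ltn_trans lt; rewrite -Sg -[leqRHS]addn0 size_act.
  apply/mem_munn_pairs; split; [exact: is_tree_munn| |exact: act_munn|split=> //].
    apply: leq_trans lt; rewrite -Sg; exact: card_munn.
  apply: geodesic_trunk_avoids HB _ => w' Ew'; rewrite Sg.
  by case: Hg => _; apply; rewrite Ew' Eg.
- move=> [k g] /Hp[lt Hg] /=; have [/= Eg Sg] := Hf (k, g) Hg.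
  set w := f (k, g) in Eg Sg *.
  by apply: ler_wiXn2l; rewrite ?(ltW z0) // -Sg; exact: cost_munn.
- by move=> q; exact: exprz_ge0.
Qed.

End Balls.
End Growth.

(** * Strictness *)

Section Tightness.
Local Open Scope ring_scope.
Variables (R : realType) (X : finType) (M : inverseMonoidType) (i : X -> M).
Local Notation L := (X + X)%type.

Lemma growth_rateE (N : inverseMonoidType) (j : X -> N) :
  growth_rate j R = root_rate R (growth j).
Proof. by []. Qed.

(** The powers of a generator have length n for each n, and the growth is at most
    exponential. *)
Lemma growth_rate_fim_fin (x : X) : exists2 r : R, 1 <= r &
  growth_rate (fim_gen : X -> FIM X) R = r%:E.
Proof.
set rate := growth_rate _ _.
have le1 : (1%:E <= rate)%E.
  rewrite /rate /growth_rate limn_esup_inf; apply: le_ereal_inf_tmp => _ [n _ <-].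
  apply: le_ereal_sup_tmp; exists (((growth (fim_gen : X -> FIM X) n.+1)%:R `^ n.+1%:R^-1)%:E).
    by exists n.+1 => //=.
  have {1}<- : (1 : R) `^ n.+1%:R^-1 = 1 by rewrite powR1.
  rewrite lee_fin ge0_ler_powR ?nnegrE ?invr_ge0 //.
  by rewrite -[1]/(1%:R) ler_nat growth_fim_gt0.
have leK : (rate <= (growth (fim_gen : X -> FIM X) 1)%:R%:E)%E.
  by apply: (@root_rate_le _ _ _ 0%N) => // n _; rewrite -natrX ler_nat growth_le_expn.
have fin : rate \is a fin_num.
  rewrite fin_numE; apply/andP; split; first by apply: contraTneq le1 => ->.
  by apply: contraTneq leK => ->.
by exists (fine rate); [rewrite -lee_fin fineK|rewrite fineK].
Qed.

(** A tree with n vertices has cost less than 2n, hence the exponent 2k. *)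
Lemma munn_sum_subexp (r : R) : 1 <= r ->
  (growth_rate (fim_gen : X -> FIM X) R <= r%:E)%E -> forall (s : R) k, 1 < s ->
  exists C, forall m a l,
    munn_sum r^-1 (pred0 : pred {fset seq L}) [:: a] l (m * k).+1 <= C * s ^+ m.
Proof.
move=> r1 rate s k s1; have r0 : 0 < r by exact: lt_le_trans ltr01 r1.
have z0 : 0 < r^-1 by rewrite invr_gt0.
have z1 : r^-1 <= 1 by rewrite invf_le1.
have [t t1 ts] := root_gt1 (2 * k) s1.
have [D D0 HD] := partial_sums_subexp r0 rate t1.
exists (D * t ^+ 2) => m a l; apply: le_trans (munn_sum_le_ball z0 z1 _ _ _) _.
under eq_bigr do rewrite exprVn; apply: le_trans (HD _) _.
rewrite -mulrA; apply: ler_wpM2l => //.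
have -> : (2 * (m * k).+1 = 2 + (2 * k) * m)%N by lia.
have [t0 s0] : 0 <= t /\ 0 <= s by split; apply: le_trans ler01 _; exact: ltW.
by rewrite exprD exprM ler_wpM2l ?exprn_ge0 // lerXn2r ?nnegrE ?exprn_ge0.
Qed.

(** The forbidden decorations make the sum of the transfer powers geometric. *)
Lemma ball_bounded (x y : X) u v (r : R) : x != y ->
  eval_word i u = eval_word i v -> (\pi_(FIM X) u)%qT <> (\pi_(FIM X) v)%qT ->
  1 <= r -> (growth_rate (fim_gen : X -> FIM X) R <= r%:E)%E ->
  exists C n0, forall n, (n0 <= n)%N -> \sum_(k < n) (growth i k)%:R * r^-1 ^+ k <= C.
Proof.
move=> xy Euv Nuv r1 rate; have r0 : 0 < r by exact: lt_le_trans ltr01 r1.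
have z0 : 0 < r^-1 by rewrite invr_gt0.
have z1 : r^-1 <= 1 by rewrite invf_le1.
have [u' [v' [Euv' Nsub]]] : exists u' v', eval_word i u' = eval_word i v' /\
    ~ {subset munn u' <= munn v'}.
  by apply: (distinct_trees xy Euv) => /munn_vagner.
have /choice[bad badP] := fun d => shortcut_exists d xy Euv' Nsub.
pose B : pred {fset seq L} := fun T => `[< shortcut i T >].
have badB d : [/\ B (bad d), is_tree (bad d) & forall a, [:: a] \in bad d -> a = d].
  by have [T1 T2 T3] := badP d; split=> //; apply/asboolP.
have [C HC] := munn_sum_bad_bounded z0 z1 (munn_sum_subexp r1 rate) xy badB.
exists C; eexists => n /HC; apply: le_trans; apply: ball_le_munn_sum => //.
by move=> T /asboolP.
Qed.

(** With equal rates r, submultiplicativity makes every term of the series of M at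
    r^-1 at least 1, while its partial sums are bounded. *)
Lemma growth_rate_neq (x y : X) u v : x != y ->
  eval_word i u = eval_word i v -> (\pi_(FIM X) u)%qT <> (\pi_(FIM X) v)%qT ->
  growth_rate i R <> growth_rate (fim_gen : X -> FIM X) R.
Proof.
move=> xy Euv Nuv; have [r r1 Er] := growth_rate_fim_fin x; rewrite Er => Ei.
have r0 : 0 < r by exact: lt_le_trans ltr01 r1.
have [|C [n0 HC]] := ball_bounded xy Euv Nuv r1; first by rewrite Er.
have a_ge n : (0 < n)%N -> 1 <= (growth i n)%:R * r^-1 ^+ n.
  move=> n_gt0; rewrite exprVn ler_pdivlMr ?exprn_gt0 // mul1r leNgt; apply/negP => lt.
  by have := root_rate_submul (growth_submul i) n_gt0 r0 lt; rewrite -growth_rateE Ei ltxx.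
pose n := (n0 + (Num.truncn C).+1)%N.
have := HC n.+1 (leqW (leq_addr _ _)); apply/negP; rewrite -ltNge.
apply: (@lt_le_trans _ _ (n%:R)).
  by apply: lt_le_trans (real_truncnS_gt (num_real C)) _; rewrite ler_nat leq_addl.
rewrite [leRHS]big_ord_recl -[leLHS]add0r; apply: lerD.
  by rewrite mulr_ge0 // exprn_ge0 // invr_ge0 ltW.
have -> : n%:R = \sum_(k < n) (1 : R) by rewrite sumr_const card_ord.
by apply: ler_sum => k _; apply: a_ge; rewrite lift0.
Qed.

End Tightness.

Theorem theorem10p9 (R : realType) (M : inverseMonoidType) (X : {fset M})
    (hX : (2 <= #|` X|)%N) (genX : generates [set` X]) :
  (growth_rate (val : X -> M) R <= growth_rate (fim_gen : X -> FIM _) R)%E /\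
  (growth_rate (val : X -> M) R = growth_rate (fim_gen : X -> FIM _) R <->
   bijective (fim_lift (val : X -> M))).
Proof.
split.
  apply: limn_esup_mono => n; rewrite lee_fin ge0_ler_powR ?nnegrE ?invr_ge0 //.
  by rewrite ler_nat growth_lift.
split=> [E|bij]; last first.
  by rewrite /growth_rate; congr limn_esup; apply: funext => n; rewrite growth_lift_eq.
have gen : generates (range (val : X -> M)).
  have -> // : range (val : X -> M) = ([set` X])%classic.
  by apply/seteqP; split=> [_ [x _ <-]|x Xx]; [exact: valP|exists [` Xx]%fset].
have [x [y xy]] : exists x y : X, x != y.
  have : (1 < #|{: X}|)%N by rewrite -cardfE.
  by case/card_gt1P => x [y [_ _ xy]]; exists x, y.
have inj : injective (fim_lift (val : X -> M)).
  elim/fim_ind=> u; elim/fim_ind=> v; rewrite !fim_lift_pi => Euv.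
  apply/eqP/negPn/negP => /eqP N; exact: growth_rate_neq xy Euv N E.
have /choice[h Kh] : forall g, exists f, fim_lift (val : X -> M) f = g.
  move=> g; have [w <-] := eval_word_surjective gen g.
  by exists (\pi_(FIM X) w)%qT; rewrite fim_lift_pi.
by exists h => // f; apply: inj; rewrite Kh.
Qed.
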